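(* Let $\Omega$ be a domain in $\mathbb{H}$ and let $u:\Omega\to[-\infty,+\infty)$ be upper semicontinuous with $u\not\equiv-\infty$. Then $u$ is weakly subharmonic (respectively, weakly harmonic) in $\Omega$ if, and only if, for every slice preserving regular function $f:\Omega'\to\Omega$ (with $\Omega'$ a domain in $\mathbb{H}$), the composition $u\circ f$ is weakly subharmonic (respectively, weakly harmonic) in $\Omega'$.
   Context: $\mathbb{H}$ is the real algebra of quaternions with its Euclidean topology; a domain is a nonempty connected open set. $\mathbb{S}=\{q\in\mathbb{H}:q^2=-1\}$; for $I\in\mathbb{S}$, $L_I=\mathbb{R}+I\mathbb{R}\cong\mathbb{C}$, and for a domain $\Omega$, $\Omega_I=\Omega\cap L_I$. A function $f:\Omega\to\mathbb{H}$ on a domain $\Omega$ is (slice) regular if for every $I\in\mathbb{S}$ the restriction $f_I=f|_{\Omega_I}$ has continuous partial derivatives and $\frac12\left(\frac{\partial}{\partial x}+I\frac{\partial}{\partial y}\right)f_I(x+yI)\equiv0$ on $\Omega_I$. It is slice preserving if $f(\Omega_I)\subseteq L_I$ for all $I\in\mathbb{S}$. For a domain $\Omega$ let $\mathsf{us}(\Omega)$ be the set of upper semicontinuous functions $v:\Omega\to[-\infty,+\infty)$ with $v\not\equiv-\infty$. A function $v\in\mathsf{us}(\Omega)$ is called weakly subharmonic (resp. weakly harmonic) if for every $I\in\mathbb{S}$ the restriction $v_I=v|_{\Omega_I}$ is subharmonic (resp. harmonic), after the natural identification between $L_I$ and $\mathbb{C}$.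
   Formalization: ''Weakly subharmonic (harmonic)'' for u∘f means only the condition on every slice; that u∘f is upper semicontinuous on Ω' and not identically −∞ is not claimed, as it can fail (u=log|q|, f=0; or f regular but discontinuous across slices). *)

(* Defs.v *)
From HB Require Import structures.
From mathcomp Require Import all_boot all_order all_algebra.
From mathcomp Require Import all_classical all_reals all_analysis.
From mathcomp Require Import ring.

Set Implicit Arguments.
Unset Strict Implicit.
Unset Printing Implicit Defensive.

Import Order.TTheory GRing.Theory Num.Theory.
Import numFieldNormedType.Exports.

Local Open Scope classical_set_scope.
Local Open Scope ring_scope.

(* The row (a, b, c, d) stands for a + b i + c j + d k. The inherited norm is
   the sup norm of R^4, not the quaternionic modulus; it induces the Euclidean
   topology, and nothing below depends on the choice of the norm. *)
Definition quaternion (R : realType) : Type := 'rV[R]_4.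

HB.instance Definition _ (R : realType) := NormedModule.on (quaternion R).

Section QuaternionAlgebra.
Variable R : realType.
Implicit Types p q : quaternion R.

Definition quat (a b c d : R) : quaternion R :=
  \row_(i < 4) [:: a; b; c; d]`_i.

Definition qcoord (i : nat) (q : quaternion R) : R := q ord0 (inord i).

Lemma qcoordE a b c d :
  (qcoord 0 (quat a b c d) = a) * (qcoord 1 (quat a b c d) = b) *
  (qcoord 2 (quat a b c d) = c) * (qcoord 3 (quat a b c d) = d).
Proof. by rewrite /qcoord !mxE !inordK. Qed.

Lemma quaternionP p q :
  (forall i, (i < 4)%N -> qcoord i p = qcoord i q) -> p = q.
Proof.
move=> pq; apply/rowP => i; have := pq i (ltn_ord i).
by rewrite /qcoord inord_val.
Qed.

Lemma quaternionW (P : quaternion R -> Prop) :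
  (forall a b c d, P (quat a b c d)) -> forall q, P q.
Proof.
move=> Pquat q.
suff -> : q = quat (qcoord 0 q) (qcoord 1 q) (qcoord 2 q) (qcoord 3 q) by [].
by apply: quaternionP => -[|[|[|[|//]]]] _; rewrite qcoordE.
Qed.

Lemma quat_addE a b c d a' b' c' d' :
  quat a b c d + quat a' b' c' d' = quat (a + a') (b + b') (c + c') (d + d').
Proof. by apply/rowP => -[[|[|[|[|//]]]]] ?; rewrite !mxE. Qed.

Lemma quat_scaleE x a b c d :
  x *: quat a b c d = quat (x * a) (x * b) (x * c) (x * d).
Proof. by apply/rowP => -[[|[|[|[|//]]]]] ?; rewrite !mxE. Qed.

Definition quaternion_one : quaternion R := quat 1 0 0 0.

Definition quaternion_mul p q : quaternion R :=
  let a1 := qcoord 0 p in let b1 := qcoord 1 p in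
  let c1 := qcoord 2 p in let d1 := qcoord 3 p in
  let a2 := qcoord 0 q in let b2 := qcoord 1 q in
  let c2 := qcoord 2 q in let d2 := qcoord 3 q in
  quat (a1 * a2 - b1 * b2 - c1 * c2 - d1 * d2)
       (a1 * b2 + b1 * a2 + c1 * d2 - d1 * c2)
       (a1 * c2 - b1 * d2 + c1 * a2 + d1 * b2)
       (a1 * d2 + b1 * c2 - c1 * b2 + d1 * a2).

Fact quaternion_mulA : associative quaternion_mul.
Proof.
move=> p q r; rewrite /quaternion_mul !qcoordE.
by congr (quat _ _ _ _); ring.
Qed.

Fact quaternion_mul1q : left_id quaternion_one quaternion_mul.
Proof.
elim/quaternionW=> a b c d; rewrite /quaternion_mul !qcoordE.
by congr (quat _ _ _ _); ring.
Qed.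

Fact quaternion_mulq1 : right_id quaternion_one quaternion_mul.
Proof.
elim/quaternionW=> a b c d; rewrite /quaternion_mul !qcoordE.
by congr (quat _ _ _ _); ring.
Qed.

Fact quaternion_mulDl : left_distributive quaternion_mul +%R.
Proof.
elim/quaternionW=> a b c d; elim/quaternionW=> a' b' c' d' r.
rewrite quat_addE /quaternion_mul !qcoordE quat_addE.
by congr (quat _ _ _ _); ring.
Qed.

Fact quaternion_mulDr : right_distributive quaternion_mul +%R.
Proof.
move=> r; elim/quaternionW=> a b c d; elim/quaternionW=> a' b' c' d'.
rewrite quat_addE /quaternion_mul !qcoordE quat_addE.
by congr (quat _ _ _ _); ring.
Qed.

Fact quaternion_one_neq0 : quaternion_one != 0.
Proof.
apply/eqP => /(congr1 (qcoord 0)); rewrite qcoordE /qcoord mxE => /eqP.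
by rewrite oner_eq0.
Qed.

HB.instance Definition _ := GRing.Zmodule_isNzRing.Build (quaternion R)
  quaternion_mulA quaternion_mul1q quaternion_mulq1
  quaternion_mulDl quaternion_mulDr quaternion_one_neq0.

Lemma quat_mulE a b c d a' b' c' d' :
  quat a b c d * quat a' b' c' d' =
  quat (a * a' - b * b' - c * c' - d * d') (a * b' + b * a' + c * d' - d * c')
       (a * c' - b * d' + c * a' + d * b') (a * d' + b * c' - c * b' + d * a').
Proof.
by rewrite -[LHS]/(quaternion_mul _ _) /quaternion_mul !qcoordE.
Qed.

Fact quaternion_scaleAl (x : R) p q : x *: (p * q) = x *: p * q.
Proof.
elim/quaternionW: p => a b c d; elim/quaternionW: q => a' b' c' d'.
rewrite !(quat_mulE, quat_scaleE).
by congr (quat _ _ _ _); ring.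
Qed.

HB.instance Definition _ := GRing.Lmodule_isLalgebra.Build R (quaternion R)
  quaternion_scaleAl.

Fact quaternion_scaleAr (x : R) p q : x *: (p * q) = p * (x *: q).
Proof.
elim/quaternionW: p => a b c d; elim/quaternionW: q => a' b' c' d'.
rewrite !(quat_mulE, quat_scaleE).
by congr (quat _ _ _ _); ring.
Qed.

HB.instance Definition _ := GRing.Lalgebra_isAlgebra.Build R (quaternion R)
  quaternion_scaleAr.

End QuaternionAlgebra.

Definition domain (T : topologicalType) (A : set T) : Prop :=
  [/\ A !=set0, open A & connected A].

(* Functions on a subset A of T are represented by total functions on T, of
   which only the values on A matter. *)

Definition usc_on (T : topologicalType) (R : realType) (A : set T)
    (v : T -> \bar R) : Prop :=
  forall p, A p -> (v p < +oo)%E /\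
    forall a : R, (v p < a%:E)%E -> \forall p' \near within A (nbhs p),
      (v p' < a%:E)%E.

Definition us (T : topologicalType) (R : realType) (A : set T)
    (v : T -> \bar R) : Prop :=
  usc_on A v /\ exists2 p, A p & v p != -oo%E.

Section Plane.
Variable R : realType.

(* The complex number x + iy is encoded as (x, y). *)
Local Notation plane := (R * R)%type.

Definition partial_x (V : normedModType R) (f : plane -> V) : plane -> V :=
  fun z => 'D_((1, 0) : plane) f z.

Definition partial_y (V : normedModType R) (f : plane -> V) : plane -> V :=
  fun z => 'D_((0, 1) : plane) f z.

(* These notions are meant for open sets U. *)

Definition C1_on (V : normedModType R) (U : set plane) (f : plane -> V) :
    Prop :=
  [/\ forall z, U z ->
        derivable f z ((1, 0) : plane) /\ derivable f z ((0, 1) : plane),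
      {within U, continuous (partial_x f)}
    & {within U, continuous (partial_y f)}].

Definition C2_on (V : normedModType R) (U : set plane) (f : plane -> V) :
    Prop :=
  [/\ C1_on U f, C1_on U (partial_x f) & C1_on U (partial_y f)].

Definition laplacian (h : plane -> R) : plane -> R :=
  fun z => partial_x (partial_x h) z + partial_y (partial_y h) z.

Definition harmonic_on (U : set plane) (w : plane -> \bar R) : Prop :=
  [/\ forall z, U z -> w z \is a fin_num,
      C2_on U (fine \o w)
    & forall z, U z -> laplacian (fine \o w) z = 0].

(* The balls of the normed space R * R are squares, hence the explicit
   Euclidean disc. *)
Definition closed_disc (a : plane) (r : R) : set plane :=
  [set z | (z.1 - a.1) ^+ 2 + (z.2 - a.2) ^+ 2 <= r ^+ 2].

Definition circle_pt (a : plane) (r t : R) : plane :=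
  (a.1 + r * cos t, a.2 + r * sin t).

(* The constant -oo is subharmonic. In the mean, w is bounded above on the
   circle, so that the integral is well defined in [-oo, +oo). *)
Definition subharmonic_on (U : set plane) (w : plane -> \bar R) : Prop :=
  usc_on U w /\
  forall (a : plane) (r : R), 0 < r -> closed_disc a r `<=` U ->
    (w a <= ((2 * pi)^-1)%:E *
      \int[@lebesgue_measure R]_(t in `[0%R, (2 * pi)%R]) w (circle_pt a r t))%E.

End Plane.

Section Slices.
Variable R : realType.
Local Notation H := (quaternion R).

Definition imaginary_sphere : set H := [set q | q ^+ 2 = -1].

Definition slice_pt (I : H) (z : R * R) : H := z.1%:A + z.2 *: I.

Definition slice (I : H) : set H := range (slice_pt I).

(* Omega_I, read in the coordinates (x, y) of x + yI *)
Definition slice_coord (I : H) (Omega : set H) : set (R * R) :=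
  slice_pt I @^-1` Omega.

Definition slice_regular (Omega : set H) (f : H -> H) : Prop :=
  forall I, imaginary_sphere I ->
    let f_I := f \o slice_pt I in
    C1_on (slice_coord I Omega) f_I /\
    forall z, slice_coord I Omega z ->
      2^-1 *: (partial_x f_I z + I * partial_y f_I z) = 0.

Definition slice_preserving (Omega : set H) (f : H -> H) : Prop :=
  forall I, imaginary_sphere I ->
    f @` (Omega `&` slice I) `<=` slice I.

(* These are the conditions on the slices only; v \in us Omega is to be
   assumed separately. It is not inherited by compositions u \o f: away from
   the real axis a regular function may be discontinuous across the slices, so
   that u \o f need not be upper semicontinuous on Omega, and u \o f may be
   identically -oo, for instance if f is constant. *)

Definition weakly_subharmonic (Omega : set H) (v : H -> \bar R) : Prop :=
  forall I, imaginary_sphere I ->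
    subharmonic_on (slice_coord I Omega) (v \o slice_pt I).

Definition weakly_harmonic (Omega : set H) (v : H -> \bar R) : Prop :=
  forall I, imaginary_sphere I ->
    harmonic_on (slice_coord I Omega) (v \o slice_pt I).

End Slices.

(* Main.v *)
Require Import Defs.
From mathcomp Require Import all_boot all_order all_algebra.
From mathcomp Require Import all_classical all_reals all_analysis.
From mathcomp Require Import measurable_realfun ring lra.

(* On a slice, a slice preserving regular function is a holomorphic function
   g = p + i q, so the theorem reduces to compositions w o g in the plane, the
   converse being the case f = id.

   Harmonic case. The means of Re (g e^(-it)) and Im (g e^(-it)) over circles of
   radius s are s Re g' and s Im g' at the center; differentiating these formulas
   under the integral sign shows that g' is again C1 and holomorphic, and the chain
   rule gives the vanishing of the laplacian of w o g.

   Subharmonic case. Critical points of g prevent a local inversion. Instead,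
   w is replaced by the decreasing continuous approximations
     F(x) = sup_y (max(w(y), -n) - k |y - x|^2).
   If y is a near-maximizer for x = g(z0), comparing with the values at
   y + g'(z0) s for x = g(z0 + s) yields F(g(z0)) <= mean of F o g over the circle
   of radius s about z0, up to o(s^2). A maximum principle for averages over
   rotations turns this into the exact inequality on every disc, and monotone
   convergence passes to the limit. *)

Set Implicit Arguments.
Unset Strict Implicit.
Unset Printing Implicit Defensive.

Import Order.TTheory GRing.Theory Num.Theory.
Import numFieldNormedType.Exports.

Local Open Scope classical_set_scope.
Local Open Scope ring_scope.

(** * Means over a period *)

Section CircleMean.
Variable R : realType.
Implicit Types (f g : R -> R).
Local Notation mu := (@lebesgue_measure R).

(** Regularity provides only C1 components, while the laplacian of w o g involves the derivatives of
    g'; hence g' has to be shown C1 first. In the subharmonic case the definition asks for the mean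
    inequality on every closed disc in the domain, whereas the composition is controlled only on
    small circles and up to an error o(s^2). Adding e |z - a|^2, whose mean over a circle of radius
    s exceeds its central value by s^2, absorbs that error. The usual comparison with a harmonic
    function having the same boundary values is replaced by averaging over N rotations about the
    center: the averaged boundary values are nearly constant, so a constant is a sufficient
    majorant. This calls for a continuous function, while w may jump and take the value -oo;
    truncation at -n and sup-convolution repair both. Sup-convolution suits the composition because
    it uses the mean inequality of w only on discs of radius |g'(z0)| s about y. The penalty k must
    keep near-maximizers so close to g(z0) that these discs stay in the domain, and must grow fast
    enough with n to bring F down to w. *)

Definition cmean f : R := (2 * pi)^-1 * \int[mu]_(t in `[0, 2 * pi]) f t.

Lemma pi2_gt0 : 0 < 2 * pi :> R.
Proof. by rewrite mulr_gt0 ?pi_gt0. Qed.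

Lemma pi2_neq0 : 2 * pi != 0 :> R.
Proof. by rewrite gt_eqF ?pi2_gt0. Qed.

Lemma continuous_integrable_itv f (a b : R) : continuous f ->
  mu.-integrable `[a, b] (EFin \o f).
Proof.
move=> cf; apply: continuous_compact_integrable; first exact: segment_compact.
exact: continuous_subspaceT.
Qed.

Lemma EFin_cmean f : continuous f ->
  ((cmean f)%:E =
   (2 * pi)^-1%:E * \int[mu]_(t in `[0%R, (2 * pi)%R]) (f t)%:E)%E.
Proof.
move=> cf; rewrite /cmean EFinM; congr (_ * _)%E.
by rewrite fineK// integrable_fin_num//; exact: continuous_integrable_itv.
Qed.

Lemma eq_cmean f g : f =1 g -> cmean f = cmean g.
Proof. by move=> /funext ->. Qed.

Lemma cmean_cst (c : R) : cmean (fun=> c) = c.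
Proof.
have mu2 : fine (mu `[0, 2 * pi]) = 2 * pi.
  by rewrite lebesgue_measure_itv/= lte_fin pi2_gt0 oppr0 addr0.
rewrite /cmean (Rintegral_cst mu (measurable_itv _)) mu2.
by rewrite mulrCA mulVf ?mulr1// pi2_neq0.
Qed.

Lemma cmeanD f g : continuous f -> continuous g ->
  cmean (fun t => f t + g t) = cmean f + cmean g.
Proof.
move=> cf cg; rewrite /cmean -mulrDr; congr (_ * _).
by apply: RintegralD => //; exact: continuous_integrable_itv.
Qed.

Lemma cmeanZ (k : R) f : continuous f ->
  cmean (fun t => k * f t) = k * cmean f.
Proof.
move=> cf; rewrite /cmean [RHS]mulrCA; congr (_ * _).
by apply: RintegralZl => //; exact: continuous_integrable_itv.
Qed.

Lemma cmeanB f g : continuous f -> continuous g ->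
  cmean (fun t => f t - g t) = cmean f - cmean g.
Proof.
move=> cf cg; rewrite /cmean -mulrBr; congr (_ * _).
by apply: RintegralB => //; exact: continuous_integrable_itv.
Qed.

Lemma le_cmean f g : continuous f -> continuous g ->
    (forall t, 0 <= t <= 2 * pi -> f t <= g t) ->
  cmean f <= cmean g.
Proof.
move=> cf cg fg; rewrite ler_pM2l ?invr_gt0 ?pi2_gt0//.
by apply: le_Rintegral => //; exact: continuous_integrable_itv.
Qed.

Lemma for_continuous_sum (T : topologicalType) (I : Type) (s : seq I)
    (f : I -> T -> R) (x : T) : (forall i, {for x, continuous (f i)}) ->
  {for x, continuous (fun y => \sum_(i <- s) f i y)}.
Proof.
move=> cf; elim: s => [|i s IH].
  rewrite (_ : (fun y => _) = fun=> 0); first exact: cvg_cst.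
  by apply/funext => y; rewrite big_nil.
rewrite (_ : (fun y => _) = fun y => f i y + \sum_(i <- s) f i y).
  exact: continuousD.
by apply/funext => y; rewrite big_cons.
Qed.

Lemma continuous_sum (I : Type) (s : seq I) (f : I -> R -> R) :
  (forall i, continuous (f i)) -> continuous (fun t => \sum_(i <- s) f i t).
Proof. by move=> cf x; apply: (for_continuous_sum (x := x)) => i; exact: cf. Qed.

Lemma cmean_sum (I : Type) (s : seq I) (f : I -> R -> R) :
  (forall i, continuous (f i)) ->
  cmean (fun t => \sum_(i <- s) f i t) = \sum_(i <- s) cmean (f i).
Proof.
move=> cf; elim: s => [|i s IH].
  by under eq_cmean do rewrite big_nil; rewrite big_nil cmean_cst.
under eq_cmean do rewrite big_cons.
by rewrite big_cons cmeanD ?IH//; exact: continuous_sum.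
Qed.

Lemma ler_norm_cmean f (M : R) : continuous f ->
    (forall t, 0 <= t <= 2 * pi -> `|f t| <= M) ->
  `|cmean f| <= M.
Proof.
move=> cf fM; rewrite ler_norml -[M in X in _ && X]cmean_cst.
rewrite -[- M]cmean_cst; apply/andP; split; apply: le_cmean => //;
  try (by move=> x; exact: cvg_cst);
  by move=> t /fM; rewrite ler_norml => /andP[].
Qed.

Lemma cmean_is_derive (f F : R -> R) : continuous f ->
  (forall x : R, 0 <= x <= 2 * pi -> is_derive x 1 F (f x)) ->
  cmean f = (2 * pi)^-1 * (F (2 * pi) - F 0).
Proof.
move=> cf dF; congr (_ * _).
have cF x : 0 <= x <= 2 * pi -> {for x, continuous F}.
  move=> /dF[dFx _].
  by apply/differentiable_continuous/derivable1_diffP.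
rewrite /Rintegral (@continuous_FTC2 _ f F)//.
- exact: pi2_gt0.
- exact: continuous_subspaceT.
- split.
  + move=> x; rewrite in_itv/= => /andP[x0 x2].
    by have [] : is_derive x 1 F (f x) by apply: dF; rewrite !ltW.
  + apply: cvg_at_right_filter; apply: cF.
    by rewrite lexx ltW ?pi2_gt0.
  + apply: cvg_at_left_filter; apply: cF.
    by rewrite lexx ltW ?pi2_gt0.
- move=> x; rewrite in_itv/= => /andP[x0 x2].
  by rewrite derive1E; have [] : is_derive x 1 F (f x) by apply: dF; rewrite !ltW.
Qed.

(** The integral starts at the base point -B, so it is a primitive only on ]-B, B[; each use chooses
    B beyond all the points that it visits. *)
Lemma continuous_primitive f (B : R) : continuous f ->
  exists F : R -> R, forall x : R, `|x| < B -> is_derive x 1 F (f x).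
Proof.
move=> cf; exists (fun x => \int[mu]_(t in `[- B, x]) f t) => x.
rewrite ltr_norml => /andP[Bx xB].
have [dF Ff] := continuous_FTC1_closed xB
  (continuous_integrable_itv (- B) B cf) Bx (cf x).
by split; rewrite -?derive1E.
Qed.

Definition periodic2pi f := forall t, f (t + 2 * pi) = f t.

Lemma is_derive_comp_shift f (k x d : R) : is_derive (x + k) 1 f d ->
  is_derive x 1 (fun y => f (y + k)) d.
Proof.
move=> df; have ds : is_derive x 1 (fun y : R => y + k) 1.
  exact: is_derive_shift.
by have := is_derive1_comp (g := fun y : R => y + k) df ds; rewrite mulr1.
Qed.

(** For a primitive F of f, the function F (x + 2 pi) - F x has derivative f (x + 2 pi) - f x = 0;
    its values at b and at 0 are the two integrals. *)
Lemma cmean_shift f (b : R) : continuous f -> periodic2pi f ->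
  cmean (fun t => f (t + b)) = cmean f.
Proof.
move=> cf pf; have [F dF] := continuous_primitive (2 * pi + `|b| + 1) cf.
have pi0 := pi2_gt0.
have FB (x : R) : `|x| <= 2 * pi + `|b| -> is_derive x 1 F (f x).
  by move=> xB; apply: dF; rewrite (le_lt_trans xB)// ltrDl.
have dsh (k x : R) : `|x + k| <= 2 * pi + `|b| ->
    is_derive x 1 (fun y : R => F (y + k)) (f (x + k)).
  by move=> /FB; exact: is_derive_comp_shift.
have cfb : continuous (fun t => f (t + b)).
  move=> x; apply: continuous_comp; last exact: cf.
  by apply: cvgD; [exact: cvg_id|exact: cvg_cst].
have dFb (x : R) : 0 <= x <= 2 * pi ->
    is_derive x 1 (fun y : R => F (y + b)) (f (x + b)).
  move=> /andP[x0 x2]; apply: dsh.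
  by rewrite (le_trans (ler_normD _ _))// lerD2r ger0_norm.
have dF0 (x : R) : 0 <= x <= 2 * pi -> is_derive x 1 F (f x).
  move=> /andP[x0 x2]; apply: FB; rewrite ger0_norm//.
  by rewrite (le_trans x2)// lerDl.
rewrite (cmean_is_derive cfb dFb) (cmean_is_derive cf dF0).
congr (_ * _).
pose G (x : R) := F (x + 2 * pi) - F x.
have dG (x : R) : `|x| <= `|b| -> is_derive x 1 G 0.
  move=> xb.
  have d1 : is_derive x 1 (fun y : R => F (y + 2 * pi)) (f (x + 2 * pi)).
    by apply: dsh; rewrite (le_trans (ler_normD _ _))// addrC lerD// ger0_norm// ltW.
  have d2 : is_derive x 1 F (f x).
    by apply: FB; rewrite (le_trans xb)// lerDr ltW.
  by have := is_deriveB d1 d2; rewrite pf subrr.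
suff : G b = G 0 by rewrite /G !add0r => <-; rewrite [2 * pi + b]addrC.
have [b0|b0] := leP 0 b.
  have [||c _] := @MVT_segment _ G (fun=> 0) 0 b b0.
  - move=> x; rewrite in_itv/= => /andP[x0 xb]; apply: dG.
    by rewrite !ger0_norm// ltW.
  - apply: derivable_within_continuous => x; rewrite in_itv/= => /andP[x0 xb].
    by have [] : is_derive x 1 G 0 by apply: dG; rewrite !ger0_norm.
  by rewrite mul0r => /eqP; rewrite subr_eq0 => /eqP.
have [||c _] := @MVT_segment _ G (fun=> 0) b 0 (ltW b0).
- move=> x; rewrite in_itv/= => /andP[bx x0]; apply: dG.
  by rewrite !ltr0_norm// lerN2 ltW.
- apply: derivable_within_continuous => x; rewrite in_itv/= => /andP[bx x0].
  by have [] : is_derive x 1 G 0 by apply: dG; rewrite ler0_norm// ltr0_norm// lerN2.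
by rewrite mul0r => /eqP; rewrite subr_eq0 => /eqP.
Qed.

(** A tube lemma: near each point of {z0} x K the increment is small on a product neighborhood, and
    compactness of K makes the neighborhood of z0 uniform. *)
Lemma near_uniform_compact (T : topologicalType) (F : T -> R -> R) (z0 : T)
    (K : set R) (e : R) : compact K -> 0 < e ->
  (forall t, K t -> {for (z0, t), continuous (fun w : T * R => F w.1 w.2)}) ->
  \forall z \near z0, forall t, K t -> `|F z t - F z0 t| < e.
Proof.
move=> /compact_near_coveringP cK e0 cF.
apply: (cK T (nbhs z0) (fun z t => `|F z t - F z0 t| < e)) => t0 Kt0.
have e20 : 0 < e / 2 by rewrite divr_gt0.
have /cvgrPdist_lt/(_ _ e20) := cF t0 Kt0.
case=> -[A B] /= [Az Bt] AB.
exists (B, A) => //= -[t z] /= [Bt' Az'].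
have h1 := AB (z, t) (conj Az' Bt').
have h2 := AB (z0, t) (conj (nbhs_singleton Az) Bt').
rewrite (splitr e) -(subrKA (F z0 t0)).
by rewrite (le_lt_trans (ler_normD _ _))// ltrD// distrC.
Qed.

Lemma continuous_pair (T U V : topologicalType) (f : T -> U) (g : T -> V) (x : T) :
  {for x, continuous f} -> {for x, continuous g} ->
  {for x, continuous (fun y => (f y, g y))}.
Proof. by move=> cf cg; exact: (cvg_pair cf cg). Qed.

Lemma for_continuous f : (forall t : R, {for t, continuous f}) -> continuous f.
Proof. by []. Qed.

Lemma continuousDR (T : topologicalType) (f g : T -> R) (x : T) :
  {for x, continuous f} -> {for x, continuous g} ->
  {for x, continuous (fun y => f y + g y)}.
Proof. exact: continuousD. Qed.

Lemma continuousBR (T : topologicalType) (f g : T -> R) (x : T) :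
  {for x, continuous f} -> {for x, continuous g} ->
  {for x, continuous (fun y => f y - g y)}.
Proof. exact: continuousB. Qed.

Lemma continuousMR (T : topologicalType) (f g : T -> R) (x : T) :
  {for x, continuous f} -> {for x, continuous g} ->
  {for x, continuous (fun y => f y * g y)}.
Proof. exact: continuousM. Qed.

Lemma continuous_section (T : topologicalType) (F : T -> R -> R) (z : T) (t : R) :
  {for (z, t), continuous (fun w : T * R => F w.1 w.2)} ->
  {for t, continuous (F z)}.
Proof.
move=> cF.
apply: (@continuous_comp _ _ _ (fun t => (z, t)) (fun w => F w.1 w.2)) => //.
by apply: continuous_pair; [exact: cvg_cst|exact: cvg_id].
Qed.

Lemma cmean_continuous (T : topologicalType) (F : T -> R -> R) (A : set T) :
  open A ->
  (forall z t, A z -> {for (z, t), continuous (fun w : T * R => F w.1 w.2)}) ->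
  forall z, A z -> {for z, continuous (fun z' => cmean (F z'))}.
Proof.
move=> oA cF z Az.
have cFz z' : A z' -> continuous (F z').
  by move=> Az' t; exact/continuous_section/cF.
apply/cvgrPdist_le => e e0.
have cK := @segment_compact R 0 (2 * pi).
have U := near_uniform_compact cK e0 (fun t _ => cF z t Az).
near=> z'.
have Az' : A z' by near: z'; exact: open_nbhs_nbhs.
rewrite -cmeanB; [|exact: cFz|exact: cFz].
apply: ler_norm_cmean => [x|t t2].
  by apply: continuousB; exact: cFz.
rewrite distrC; apply: ltW.
by move: t t2; near: z'; apply: filterS U => z' h t t2; apply: h; rewrite /= in_itv.
Unshelve. all: by end_near. Qed.

(** A constant serves as the dominating function: [dF a] is bounded on the compact period, and
    [dF s] stays within 1 of it for s near a. *)
Lemma is_derive_cmean (F dF : R -> R -> R) (u v a : R) :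
  u < a < v ->
  (forall s t, u < s < v -> {for (s, t), continuous (fun w : R * R => F w.1 w.2)}) ->
  (forall s t, u < s < v -> {for (s, t), continuous (fun w : R * R => dF w.1 w.2)}) ->
  (forall s t, u < s < v -> is_derive s 1 (F ^~ t) (dF s t)) ->
  is_derive a 1 (fun s => cmean (F s)) (cmean (dF a)).
Proof.
move=> auv cF cdF DF.
have cFz (G : R -> R -> R) : (forall s t, u < s < v ->
    {for (s, t), continuous (fun w : R * R => G w.1 w.2)}) ->
    forall s, u < s < v -> continuous (G s).
  by move=> cG s sv t; exact/continuous_section/cG.
have cK := @segment_compact R 0 (2 * pi).
have U := near_uniform_compact cK (ltr01) (fun t _ => cdF a t auv).
have : \forall s \near a, u < s < v /\
    (forall t, `[0, 2 * pi]%classic t -> `|dF s t - dF a t| < 1).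
  near=> s; split; last by near: s.
  by apply/andP; split; near: s; [apply: lt_nbhsr|apply: lt_nbhsl];
    case/andP: auv.
case/nbhs_ballP => e /= e0 ae.
have [M [Mr HM]] : bounded_set (dF a @` `[0, 2 * pi]).
  apply: compact_bounded; apply: continuous_compact => //.
  by apply: continuous_subspaceT; exact: cFz.
pose M1 := `|M| + 1 + 1.
have Hb (t : R) : `[0, 2 * pi]%classic t -> `|dF a t| <= `|M| + 1.
  move=> t2; apply: (HM (`|M| + 1)); last by exists t.
  by rewrite (le_lt_trans (ler_norm M))// ltrDl.
have iI s : `](a - e), (a + e)[%classic s -> u < s < v /\
    (forall t, `[0, 2 * pi]%classic t -> `|dF s t - dF a t| < 1).
  by rewrite /= in_itv/= => h; apply: ae; rewrite /ball/= ltr_distlC.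
have d1 s t : u < s < v -> partial1of2 F s t = dF s t.
  by move=> suv; rewrite partial1of2E; have [_ ->] := DF s t suv.
have Ia : `](a - e), (a + e)[%classic a.
  by rewrite /= in_itv/= ltrBlDr !ltrDl e0.
have key := @differentiation_under_integral R _ _ mu F `[0, 2 * pi]
  (measurable_itv _) a (a - e) (a + e) Ia.
have key2 := @derivable_under_integral R _ _ mu F `[0, 2 * pi]
  (measurable_itv _) a (a - e) (a + e) Ia.
have h1 x : `](a - e), (a + e)[%classic x ->
    mu.-integrable `[0, 2 * pi] (EFin \o F x).
  by move=> /iI[xuv _]; apply: continuous_integrable_itv; exact: cFz.
have h2 x y : `](a - e), (a + e)[%classic x -> `[0, 2 * pi]%classic y ->
    derivable (F ^~ y) x 1.
  by move=> /iI[xuv _] _; have [] := DF x y xuv.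
have h3 : forall y : R, 0 <= M1 by move=> _; rewrite !addr_ge0.
have h4 : mu.-integrable `[0, 2 * pi] (EFin \o (fun=> M1)).
  by apply: continuous_integrable_itv => x; exact: cvg_cst.
have h5 x y : `](a - e), (a + e)[%classic x -> `[0, 2 * pi]%classic y ->
    `|partial1of2 F x y| <= M1.
  move=> /iI[xuv xy] y2; rewrite d1//.
  have A := ltW (xy y y2); have B := Hb y y2.
  rewrite -[dF x y](subrK (dF a y)) (le_trans (ler_normD _ _))//.
  by rewrite /M1 addrC lerD.
have {}key := key h1 h2 (fun=> M1) h3 h4 h5.
have {}key2 := key2 h1 h2 (fun=> M1) h3 h4 h5.
have dI : is_derive a 1 (fun s => \int[mu]_(t in `[0, 2 * pi]) F s t)
    (\int[mu]_(t in `[0, 2 * pi]) dF a t).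
  split => //; rewrite -derive1E key; apply: eq_Rintegral => t _.
  by rewrite d1.
exact: (is_deriveZ (2 * pi)^-1 dI).
Unshelve. all: by end_near. Qed.

(** The point is the uniformity in the starting angle b: N has to be fixed before the maximum point,
    whose angle b will be, is known. *)
Lemma riemann_cmean f (e : R) : continuous f -> periodic2pi f -> 0 < e ->
  exists2 N, (0 < N)%N & forall b : R, 0 <= b <= 2 * pi ->
    `|N%:R^-1 * \sum_(k < N) f (b + 2 * pi * k%:R / N%:R) - cmean f| <= e.
Proof.
move=> cf pf e0; have pi0 := pi2_gt0.
have cK := @segment_compact R 0 (4 * pi).
have cfD (z t : R) : {for (z, t), continuous (fun w : R * R => f (w.2 + w.1))}.
  apply: (@continuous_comp _ _ _ (fun w : R * R => w.2 + w.1) f); last exact: cf.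
  by apply: cvgD; [exact: cvg_snd|exact: cvg_fst].
have := @near_uniform_compact _ (fun z t => f (t + z)) 0 _ e cK e0
  (fun t _ => cfD 0 t).
case/nbhs_ballP => d /= d0 dP.
(* The mesh is made smaller than the modulus d of f on [0, 4 pi], an interval containing every b + 2
   pi k / N. On each piece the mean value theorem then replaces the integral by a value of f within
   e of the one at the node. *)
have [N N0 Nd] : exists2 N, (0 < N)%N & 2 * pi / N%:R < d.
  exists (Num.truncn (2 * pi / d)).+1 => //.
  rewrite ltr_pdivrMr// [ltRHS]mulrC -ltr_pdivrMr//.
  exact: truncnS_gt.
have Nr0 : 0 < N%:R :> R by rewrite ltr0n.
exists N => // b /andP[b0 b2].
pose h : R := 2 * pi / N%:R.
have h0 : 0 < h by rewrite /h divr_gt0.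
have [F dF] := continuous_primitive (4 * pi + 1) cf.
have FB (x : R) : 0 <= x <= 4 * pi -> is_derive x 1 F (f x).
  move=> /andP[x0 x4]; apply: dF.
  by rewrite ger0_norm// (le_lt_trans x4)// ltrDl.
pose x (k : nat) : R := b + 2 * pi * k%:R / N%:R.
have xS k : x k.+1 = x k + h by rewrite /x /h; field; rewrite gt_eqF.
have x0 k : 0 <= x k.
  by rewrite /x addr_ge0// divr_ge0// mulr_ge0// ?ler0n// ltW.
have x4 k : (k <= N)%N -> x k <= 4 * pi.
  move=> kN; rewrite /x (_ : 4 * pi = 2 * pi + 2 * pi :> R); last by ring.
  by rewrite lerD// ler_pdivrMr// ler_pM2l// ler_nat.
rewrite -(cmean_shift b cf pf).
have cfb : continuous (fun t => f (t + b)).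
  move=> t; apply: continuous_comp; last exact: cf.
  by apply: cvgD; [exact: cvg_id|exact: cvg_cst].
have dFb (t : R) : 0 <= t <= 2 * pi ->
    is_derive t 1 (fun y : R => F (y + b)) (f (t + b)).
  move=> /andP[t0 t2]; apply: is_derive_comp_shift.
  by apply: FB; rewrite addr_ge0//=; lra.
rewrite (cmean_is_derive cfb dFb).
have -> : F (2 * pi + b) - F (0 + b) = \sum_(k < N) (F (x k.+1) - F (x k)).
  rewrite -(big_mkord xpredT (fun k => F (x k.+1) - F (x k))).
  rewrite telescope_sumr//; congr (F _ - F _).
    by rewrite /x; field; rewrite gt_eqF.
  by rewrite /x mulr0 mul0r addr0 add0r.
rewrite !mulr_sumr -sumrB.
apply: (le_trans (ler_norm_sum _ _ _)).
apply: (@le_trans _ _ (\sum_(k < N) N%:R^-1 * e)); last first.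
  by rewrite sumr_const card_ord -[leLHS]mulr_natl mulrA mulfV ?mul1r// gt_eqF.
apply: ler_sum => k _.
have xkS : x k <= x k.+1 by rewrite xS lerDl ltW.
have [||c] := @MVT_segment _ F f (x k) (x k.+1) xkS.
- move=> y; rewrite in_itv/= => /andP[xy yx]; apply: FB.
  rewrite (le_trans (x0 k) (ltW xy)) /= (le_trans (ltW yx))//; exact: x4 (ltn_ord k).
- apply: derivable_within_continuous => y; rewrite in_itv/= => /andP[xy yx].
  have [] // : is_derive y 1 F (f y).
  apply: FB; rewrite (le_trans (x0 k) xy) /= (le_trans yx)//; exact: x4 (ltn_ord k).
rewrite in_itv/= => /andP[xc cx] ->.
rewrite -/(x k) xS (addrC (x k)) addrK.
have -> : (2 * pi)^-1 * (f c * h) = N%:R^-1 * f c.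
  by rewrite /h mulrCA [X in f c * X]mulrA mulVf ?gt_eqF// mul1r mulrC.
rewrite -mulrBr normrM ger0_norm ?invr_ge0 ?ler0n// ler_pM2l ?invr_gt0//.
have cB : ball 0 d (c - x k).
  rewrite /ball/= sub0r normrN ger0_norm ?subr_ge0//.
  by rewrite (le_lt_trans _ Nd)// lerBlDl -xS.
have xK : `[0, 4 * pi]%classic (x k) by rewrite /= in_itv/= x0 x4// ltnW.
have := dP _ cB _ xK.
by rewrite (addrC (x k) (c - x k)) subrK addr0 distrC => /ltW.
Qed.

End CircleMean.

(** * Calculus of C1 functions in the plane *)

Section PlaneC1.
Variable R : realType.
Local Notation plane := (R * R)%type.
Implicit Types (f : plane -> R) (U V : set plane) (z : plane).

(** A division-free form, in which the error terms of the chain rule can be added. *)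
Lemma is_derive1P (f : R -> R) (t d : R) :
  is_derive t 1 f d <-> forall e, 0 < e ->
    \forall h \near (0 : R), `|f (t + h) - f t - d * h| <= e * `|h|.
Proof.
have E h : h^-1 *: (f (h *: 1 + t) - f t) = h^-1 * (f (t + h) - f t).
  by rewrite [h *: 1]mulr1 (addrC t).
split => [[df <-] e e0|H].
  move/cvgrPdist_le : df => /(_ e e0).
  rewrite near_withinE; apply: filterS => h /= H.
  have [->|h0] := eqVneq h 0.
    by rewrite addr0 subrr mulr0 subrr normr0 mulr0.
  have {H} := H h0; rewrite -/('D_1 f t) E => H.
  have -> : f (t + h) - f t - 'D_1 f t * h =
      - (h * ('D_1 f t - h^-1 * (f (t + h) - f t))) by field.
  by rewrite normrN normrM mulrC ler_wpM2r.
suff C : (fun h => h^-1 *: ((f \o shift t) (h *: 1) - f t)) @ 0^' --> d.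
  by split; [apply/cvg_ex; exists d|exact/cvg_lim].
apply/cvgrPdist_le => e e0; rewrite near_withinE.
apply: filterS (H e e0) => h /= Hh h0; rewrite E.
have -> : d - h^-1 * (f (t + h) - f t) = - (h^-1 * (f (t + h) - f t - d * h)).
  by field.
by rewrite normrN normrM normfV mulrC ler_pdivrMr ?normr_gt0.
Qed.

Lemma is_derive_xE f z (d : R) :
  is_derive z ((1, 0) : plane) f d <-> is_derive z.1 1 (fun x => f (x, z.2)) d.
Proof.
have E : (fun h : R => h^-1 *: ((f \o shift z) (h *: ((1, 0) : plane)) - f z)) =
  (fun h : R => h^-1 *: (((fun x => f (x, z.2)) \o shift z.1) (h *: 1) - f (z.1, z.2))).
  apply/funext => h /=; rewrite -surjective_pairing; congr (_ *: (f _ - _)).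
  by apply/pair_equal_spec; split => //=; rewrite [h *: 0]mulr0 add0r.
by split=> -[dF DF]; split; rewrite /derivable /derive ?E// -?E.
Qed.

Lemma is_derive_yE f z (d : R) :
  is_derive z ((0, 1) : plane) f d <-> is_derive z.2 1 (fun y => f (z.1, y)) d.
Proof.
have E : (fun h : R => h^-1 *: ((f \o shift z) (h *: ((0, 1) : plane)) - f z)) =
  (fun h : R => h^-1 *: (((fun y => f (z.1, y)) \o shift z.2) (h *: 1) - f (z.1, z.2))).
  apply/funext => h /=; rewrite -surjective_pairing; congr (_ *: (f _ - _)).
  by apply/pair_equal_spec; split => //=; rewrite [h *: 0]mulr0 add0r.
by split=> -[dF DF]; split; rewrite /derivable /derive ?E// -?E.
Qed.

Lemma MVT_dist (f df : R -> R) (a b : R) :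
  (forall x : R, `|x - a| <= `|b - a| -> is_derive x 1 f (df x)) ->
  exists2 c, `|c - a| <= `|b - a| & f b - f a = df c * (b - a).
Proof.
move=> dF.
have cf (x : R) : `|x - a| <= `|b - a| -> derivable f x 1 by case/dF.
have [ab|ba] := leP a b.
  have I (x : R) : a <= x <= b -> `|x - a| <= `|b - a|.
    by move=> /andP[ax xb]; rewrite !ger0_norm ?subr_ge0// lerD2r.
  have [||c] := @MVT_segment _ f df a b ab.
  - by move=> x; rewrite in_itv/= => /andP[ax xb]; apply/dF/I; rewrite !ltW.
  - by apply: derivable_within_continuous => x; rewrite in_itv/= => /I /cf.
  by rewrite in_itv/= => /I ca E; exists c.
have I (x : R) : b <= x <= a -> `|x - a| <= `|b - a|.
  by move=> /andP[bx xa]; rewrite !ler0_norm ?subr_le0 ?(ltW ba)// lerN2 lerD2r.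
have [||c] := @MVT_segment _ f df b a (ltW ba).
- by move=> x; rewrite in_itv/= => /andP[ax xb]; apply/dF/I; rewrite !ltW.
- by apply: derivable_within_continuous => x; rewrite in_itv/= => /I /cf.
rewrite in_itv/= => /I ca E; exists c => //.
by rewrite -opprB E -mulrN opprB.
Qed.

(* [C1_on] with the partial derivatives as parameters; meant for open sets U. *)
Definition hasC1 U f fx fy := forall z, U z ->
  [/\ is_derive z ((1, 0) : plane) f (fx z), is_derive z ((0, 1) : plane) f (fy z),
      {for z, continuous fx} & {for z, continuous fy}].

(** The increment is split at the corner (z.1, z'.2), and the mean value theorem is applied to each
    of the two sides. A ball of the sup norm is a square, so it contains the corner. *)
Lemma hasC1_approx U f fx fy z (e : R) : open U -> hasC1 U f fx fy -> U z ->
  0 < e ->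
  \forall z' \near z, `|f z' - f z - fx z * (z'.1 - z.1) - fy z * (z'.2 - z.2)|
     <= e * (`|z'.1 - z.1| + `|z'.2 - z.2|).
Proof.
move=> oU f1 Uz e0; have [_ _ cx cy] := f1 z Uz.
have : \forall w \near z, [/\ U w, `|fx w - fx z| <= e & `|fy w - fy z| <= e].
  near=> w; split; near: w.
  - exact: open_nbhs_nbhs.
  - by move/cvgrPdist_le : cx => /(_ e e0); apply: filterS => w; rewrite distrC.
  - by move/cvgrPdist_le : cy => /(_ e e0); apply: filterS => w; rewrite distrC.
case/nbhs_ballP => d /= d0 Hd.
near=> z'.
have [/= b1 b2] : ball z d z' by near: z'; exact: nbhsx_ballx.
rewrite /ball/= distrC in b1; rewrite /ball/= distrC in b2.
have inB (x y : R) : `|x - z.1| < d -> `|y - z.2| < d ->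
    [/\ U (x, y), `|fx (x, y) - fx z| <= e & `|fy (x, y) - fy z| <= e].
  by move=> hx hy; apply: Hd; split; rewrite /ball/= distrC.
have d00 : `|z.1 - z.1| < d by rewrite subrr normr0.
have [|c1 hc1 E1] := @MVT_dist (fun x => f (x, z'.2)) (fun x => fx (x, z'.2)) z.1 z'.1.
  move=> x hx; have [Ux _ _] := inB _ _ (le_lt_trans hx b1) b2.
  by have [/is_derive_xE] := f1 _ Ux.
have [|c2 hc2 E2] := @MVT_dist (fun y => f (z.1, y)) (fun y => fy (z.1, y)) z.2 z'.2.
  move=> y hy; have [Uy _ _] := inB _ _ d00 (le_lt_trans hy b2).
  by have [_ /is_derive_yE] := f1 _ Uy.
have [_ A1 _] := inB _ _ (le_lt_trans hc1 b1) b2.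
have [_ _ A2] := inB _ _ d00 (le_lt_trans hc2 b2).
have -> : f z' - f z - fx z * (z'.1 - z.1) - fy z * (z'.2 - z.2) =
    (fx (c1, z'.2) - fx z) * (z'.1 - z.1) + (fy (z.1, c2) - fy z) * (z'.2 - z.2).
  rewrite !mulrBl -E1 -E2 -(surjective_pairing z') -(surjective_pairing z); ring.
rewrite (le_trans (ler_normD _ _))// [leRHS]mulrDr !normrM.
by rewrite lerD// ler_wpM2r.
Unshelve. all: by end_near. Qed.

Lemma hasC1_continuous U f fx fy z : open U -> hasC1 U f fx fy -> U z ->
  {for z, continuous f}.
Proof.
move=> oU f1 Uz; have A := hasC1_approx oU f1 Uz ltr01.
apply/cvgrPdist_le => e e0 /=.
pose k := 1 + (`|fx z| + `|fy z|).
have k0 : 0 < k by rewrite /k ltr_pwDl// addr_ge0.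
have de : 0 < e / (2 * k) by rewrite divr_gt0// mulr_gt0.
near=> z'.
have [/= b1 b2] : ball z (e / (2 * k)) z' by near: z'; exact: (nbhsx_ballx z _ de).
rewrite /ball/= distrC in b1; rewrite /ball/= distrC in b2.
have A2 : `|f z' - f z - fx z * (z'.1 - z.1) - fy z * (z'.2 - z.2)|
     <= 1 * (`|z'.1 - z.1| + `|z'.2 - z.2|) by near: z'.
have B : `|f z' - f z| <= k * (`|z'.1 - z.1| + `|z'.2 - z.2|).
  have -> : f z' - f z = (f z' - f z - fx z * (z'.1 - z.1) - fy z * (z'.2 - z.2))
    + (fx z * (z'.1 - z.1) + fy z * (z'.2 - z.2)) by ring.
  rewrite (le_trans (ler_normD _ _))//.
  rewrite /k [leRHS]mulrDl lerD//.
  rewrite (le_trans (ler_normD _ _))// !normrM.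
  have := normr_ge0 (fx z); have := normr_ge0 (fy z).
  have := normr_ge0 (z'.1 - z.1); have := normr_ge0 (z'.2 - z.2); nra.
rewrite distrC (le_trans B)//.
have -> : e = k * (e / (2 * k) + e / (2 * k)) by field; rewrite gt_eqF.
by rewrite ler_pM2l// lerD// ltW.
Unshelve. all: by end_near. Qed.

Lemma is_derive_curve U f fx fy (g1 g2 : R -> R) (t a b : R) :
  open U -> hasC1 U f fx fy -> U (g1 t, g2 t) ->
  is_derive t 1 g1 a -> is_derive t 1 g2 b ->
  is_derive t 1 (fun s => f (g1 s, g2 s)) (fx (g1 t, g2 t) * a + fy (g1 t, g2 t) * b).
Proof.
move=> oU f1 Ut d1 d2; apply/is_derive1P => e e0.
have cg : {for t, continuous (fun s => (g1 s, g2 s))}.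
  by apply: continuous_pair; apply/differentiable_continuous/derivable1_diffP;
    [case: d1|case: d2].
set z := (g1 t, g2 t) in Ut *.
(* The accuracy e / k is for the Taylor remainder of f, since the increments of g1 and g2 add up to
   at most (2 + |a| + |b|) |h|; e / m is for the remainders of g1 and g2, which get multiplied by
   the partial derivatives of f. Each source contributes e / 2. *)
pose k := 2 * (2 + (`|a| + `|b|)).
have k0 : 0 < k by rewrite mulr_gt0// ltr_pwDl// addr_ge0.
have ek : 0 < e / k by rewrite divr_gt0.
pose m := 2 * (1 + (`|fx z| + `|fy z|)).
have m0 : 0 < m by rewrite mulr_gt0// ltr_pwDl// addr_ge0.
have em : 0 < e / m by rewrite divr_gt0.
have A := hasC1_approx oU f1 Ut ek.
have A' : \forall h \near (0 : R), let w := (g1 (t + h), g2 (t + h)) in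
   `|f w - f z - fx z * (w.1 - z.1) - fy z * (w.2 - z.2)|
     <= e / k * (`|w.1 - z.1| + `|w.2 - z.2|).
  have ct : {for (0 : R), continuous (fun h : R => (g1 (t + h), g2 (t + h)))}.
    apply: (@continuous_comp _ _ _ (fun h => t + h) (fun s => (g1 s, g2 s)) 0).
      by apply: cvgD; [exact: cvg_cst|exact: cvg_id].
    by rewrite addr0.
  move: ct; rewrite /prop_for /continuous_at addr0 => ct.
  exact: ct A.
move/is_derive1P : (d1) => D1; move/is_derive1P : (d2) => D2.
near=> h.
have B1 : `|g1 (t + h) - g1 t - a * h| <= 1 * `|h|.
  by near: h; exact: D1.
have B2 : `|g2 (t + h) - g2 t - b * h| <= 1 * `|h|.
  by near: h; exact: D2.
have C1 : `|g1 (t + h) - g1 t - a * h| <= e / m * `|h|.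
  by near: h; exact: D1.
have C2 : `|g2 (t + h) - g2 t - b * h| <= e / m * `|h|.
  by near: h; exact: D2.
have A2 : let w := (g1 (t + h), g2 (t + h)) in
   `|f w - f z - fx z * (w.1 - z.1) - fy z * (w.2 - z.2)|
     <= e / k * (`|w.1 - z.1| + `|w.2 - z.2|) by near: h.
rewrite /= in A2.
have N1 : `|g1 (t + h) - g1 t| <= (1 + `|a|) * `|h|.
  rewrite -[X in `|X|](subrK (a * h)) (le_trans (ler_normD _ _))//.
  by rewrite [leRHS]mulrDl lerD// normrM.
have N2 : `|g2 (t + h) - g2 t| <= (1 + `|b|) * `|h|.
  rewrite -[X in `|X|](subrK (b * h)) (le_trans (ler_normD _ _))//.
  by rewrite [leRHS]mulrDl lerD// normrM.
have -> : f (g1 (t + h), g2 (t + h)) - f z - (fx z * a + fy z * b) * h =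
  (f (g1 (t + h), g2 (t + h)) - f z - fx z * (g1 (t + h) - g1 t)
     - fy z * (g2 (t + h) - g2 t)) +
  (fx z * (g1 (t + h) - g1 t - a * h) + fy z * (g2 (t + h) - g2 t - b * h)) by ring.
rewrite (le_trans (ler_normD _ _))// (splitr e) [leRHS]mulrDl lerD//.
  rewrite (le_trans A2)//.
  have -> : e / 2 * `|h| = e / k * ((1 + `|a|) * `|h| + (1 + `|b|) * `|h|).
    by rewrite /k; field; rewrite gt_eqF// ltr_pwDl// addr_ge0.
  by rewrite ler_pM2l// lerD.
rewrite (le_trans (ler_normD _ _))// !normrM.
have E : e / 2 * `|h| = (1 + (`|fx z| + `|fy z|)) * (e / m * `|h|).
  by rewrite /m; field; rewrite gt_eqF// ltr_pwDl// addr_ge0.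
rewrite E [leRHS]mulrDl mul1r ler_wpDl//; first by rewrite mulr_ge0// ltW.
by rewrite [leRHS]mulrDl lerD// ler_wpM2l.
Unshelve. all: by end_near. Qed.

Lemma hasC1_comp U V w w1 w2 p px py q qx qy :
  open U -> open V -> hasC1 V w w1 w2 -> hasC1 U p px py -> hasC1 U q qx qy ->
  (forall z, U z -> V (p z, q z)) ->
  hasC1 U (fun z => w (p z, q z))
    (fun z => w1 (p z, q z) * px z + w2 (p z, q z) * qx z)
    (fun z => w1 (p z, q z) * py z + w2 (p z, q z) * qy z).
Proof.
move=> oU oV W P Q UV [x y]; set z := (x, y) => Uz.
have [px' py' cpx cpy] := P z Uz; have [qx' qy' cqx cqy] := Q z Uz.
have [_ _ cw1 cw2] := W _ (UV z Uz).
have cpq : {for z, continuous (fun z => (p z, q z))}.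
  by apply: continuous_pair; [exact: hasC1_continuous P Uz|
                              exact: hasC1_continuous Q Uz].
have c1 : {for z, continuous (fun z => w1 (p z, q z))} by exact: continuous_comp.
have c2 : {for z, continuous (fun z => w2 (p z, q z))} by exact: continuous_comp.
have Vz := UV z Uz.
split.
- apply/is_derive_xE; move/is_derive_xE : px' => px'; move/is_derive_xE : qx' => qx'.
  exact: (is_derive_curve oV W Vz px' qx').
- apply/is_derive_yE; move/is_derive_yE : py' => py'; move/is_derive_yE : qy' => qy'.
  exact: (is_derive_curve oV W Vz py' qy').
- by apply: continuousD; apply: continuousM.
- by apply: continuousD; apply: continuousM.
Qed.

End PlaneC1.

(** * Holomorphic pairs and circle means *)

Section Holomorphic.
Variable R : realType.
Local Notation plane := (R * R)%type.
Implicit Types (f p q a b : plane -> R) (U V : set plane) (z : plane).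

Lemma is_deriveMR (f g : R -> R) (t df dg d : R) :
  is_derive t 1 f df -> is_derive t 1 g dg -> df * g t + f t * dg = d ->
  is_derive t 1 (fun s => f s * g s) d.
Proof.
move=> Df Dg E; apply: is_derive_eq (is_deriveM Df Dg) _.
by rewrite -E addrC; congr (_ + _); exact: mulrC.
Qed.

Lemma is_deriveDR (f g : R -> R) (t df dg d : R) :
  is_derive t 1 f df -> is_derive t 1 g dg -> df + dg = d ->
  is_derive t 1 (fun s => f s + g s) d.
Proof. by move=> Df Dg E; apply: is_derive_eq (is_deriveD Df Dg) E. Qed.

Lemma is_deriveBR (f g : R -> R) (t df dg d : R) :
  is_derive t 1 f df -> is_derive t 1 g dg -> df - dg = d ->
  is_derive t 1 (fun s => f s - g s) d.
Proof. by move=> Df Dg E; apply: is_derive_eq (is_deriveB Df Dg) E. Qed.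

Lemma is_derive_idR (t : R) : is_derive t 1 (fun s : R => s) 1.
Proof. exact: is_derive_id. Qed.

Lemma is_derive_cstR (c t : R) : is_derive t 1 (fun=> c) 0.
Proof. exact: is_derive_cst. Qed.

Lemma is_derive_affine (g : R -> R) (c k t d : R) : is_derive t 1 g d ->
  is_derive t 1 (fun x => c + k * g x) (k * d).
Proof.
move=> dg; have dM := is_deriveMR (is_derive_cstR k t) dg erefl.
by apply: is_deriveDR (is_derive_cstR c t) dM _; rewrite mul0r !add0r.
Qed.

Lemma circle_pt_disc z (r s t : R) : `|s| <= r ->
  closed_disc z r (circle_pt z s t).
Proof.
move=> sr; rewrite /closed_disc /circle_pt /=.
rewrite (addrC z.1) (addrC z.2) !addrK !exprMn -mulrDr cos2Dsin2 mulr1.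
rewrite -real_normK ?num_real// lerXn2r ?nnegrE//.
exact: le_trans (normr_ge0 s) sr.
Qed.

Lemma circle_pt_2pi z (r : R) : circle_pt z r (2 * pi) = circle_pt z r 0.
Proof.
by rewrite /circle_pt mulr_natl cos2pi sin2pi cos0 sin0.
Qed.

Lemma cosD2pi_mul (t : R) : cos (t + 2 * pi) = cos t.
Proof. by rewrite mulr_natl cosD2pi. Qed.

Lemma sinD2pi_mul (t : R) : sin (t + 2 * pi) = sin t.
Proof. by rewrite mulr_natl sinD2pi. Qed.

Lemma circle_ptD2pi z (r t : R) : circle_pt z r (t + 2 * pi) = circle_pt z r t.
Proof. by rewrite /circle_pt cosD2pi_mul sinD2pi_mul. Qed.

Lemma circle_pt0 z (t : R) : circle_pt z 0 t = z.
Proof. by rewrite /circle_pt !mul0r !addr0 -surjective_pairing. Qed.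

Lemma continuous_circle_pt (T : topologicalType) (c : T -> plane) (r s : T -> R) x :
  {for x, continuous c} -> {for x, continuous r} -> {for x, continuous s} ->
  {for x, continuous (fun y => circle_pt (c y) (r y) (s y))}.
Proof.
move=> cc cr cs.
have c1 : {for x, continuous (fun y => (c y).1)}.
  by apply: (@continuous_comp _ _ _ c fst) => //; exact: cvg_fst.
have c2 : {for x, continuous (fun y => (c y).2)}.
  by apply: (@continuous_comp _ _ _ c snd) => //; exact: cvg_snd.
have ccos : {for x, continuous (fun y => cos (s y))}.
  by apply: (@continuous_comp _ _ _ s cos) => //; exact: continuous_cos.
have csin : {for x, continuous (fun y => sin (s y))}.
  by apply: (@continuous_comp _ _ _ s sin) => //; exact: continuous_sin.
by apply: continuous_pair; apply: continuousD => //; apply: continuousM.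
Qed.

Lemma is_derive_circle_radius U f fx fy z (s t : R) :
  open U -> hasC1 U f fx fy -> U (circle_pt z s t) ->
  is_derive s 1 (fun s => f (circle_pt z s t))
    (fx (circle_pt z s t) * cos t + fy (circle_pt z s t) * sin t).
Proof.
move=> oU f1 Uc.
apply: (@is_derive_curve R U f fx fy (fun s => z.1 + s * cos t)
  (fun s => z.2 + s * sin t) s (cos t) (sin t) oU f1 Uc).
  under eq_fun do rewrite mulrC.
  by apply: is_derive_eq (is_derive_affine _ _ (is_derive_idR s)) _; rewrite mulr1.
under eq_fun do rewrite mulrC.
by apply: is_derive_eq (is_derive_affine _ _ (is_derive_idR s)) _; rewrite mulr1.
Qed.

Lemma is_derive_circle_angle U f fx fy z (s t : R) :
  open U -> hasC1 U f fx fy -> U (circle_pt z s t) ->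
  is_derive t 1 (fun t => f (circle_pt z s t))
    (fx (circle_pt z s t) * - (s * sin t) + fy (circle_pt z s t) * (s * cos t)).
Proof.
move=> oU f1 Uc.
apply: (@is_derive_curve R U f fx fy (fun t => z.1 + s * cos t)
  (fun t => z.2 + s * sin t) t (- (s * sin t)) (s * cos t) oU f1 Uc).
  rewrite -mulrN; exact: is_derive_affine.
exact: is_derive_affine.
Qed.

(* [p + i q] is holomorphic on U, with derivative [a + i b]. *)
Definition holomorphic U p q a b :=
  hasC1 U p a (fun z => - b z) /\ hasC1 U q b a.

(* This is multiplication of [p + i q] by [- i]. *)
Lemma holomorphic_rot U p q a b : holomorphic U p q a b ->
  holomorphic U q (fun z => - p z) b (fun z => - a z).
Proof.
move=> [P Q]; split.
  suff -> : (fun z => - (- a z)) = a by [].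
  by apply/funext => z; rewrite opprK.
move=> z Uz; have [px py ca cb] := P z Uz; split.
- exact: (is_deriveN px).
- by apply: is_derive_eq (is_deriveN py) _; rewrite opprK.
- exact: continuousN.
- by have [] := Q z Uz.
Qed.

Section Disc.
Variables (U : set plane) (p q a b : plane -> R) (z : plane) (r : R).
Hypotheses (oU : open U) (hU : holomorphic U p q a b).
Hypotheses (r0 : 0 < r) (rU : closed_disc z r `<=` U).

Let Uc (s t : R) : - r < s < r -> U (circle_pt z s t).
Proof.
by move=> /andP[rs sr]; apply/rU/circle_pt_disc; rewrite ler_norml !ltW.
Qed.

Let P1 : hasC1 U p a (fun z => - b z). Proof. by case: hU. Qed.
Let Q1 : hasC1 U q b a. Proof. by case: hU. Qed.

Lemma continuous_circle2 f (s t : R) : (forall z, U z -> {for z, continuous f}) ->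
  - r < s < r -> {for (s, t), continuous (fun w : R * R => f (circle_pt z w.1 w.2))}.
Proof.
move=> cf sr.
apply: (@continuous_comp _ _ _ (fun w : R * R => circle_pt z w.1 w.2) f).
  by apply: continuous_circle_pt; [exact: cvg_cst|exact: cvg_fst|exact: cvg_snd].
exact/cf/Uc.
Qed.

Lemma continuous_circle1 f (s : R) : (forall z, U z -> {for z, continuous f}) ->
  - r < s < r -> continuous (fun t : R => f (circle_pt z s t)).
Proof.
move=> cf sr t.
apply: (@continuous_section R R (fun s t => f (circle_pt z s t)) s t).
exact: continuous_circle2.
Qed.

Let cp w : U w -> {for w, continuous p}.
Proof. exact: (hasC1_continuous oU P1). Qed.
Let cq w : U w -> {for w, continuous q}.
Proof. exact: (hasC1_continuous oU Q1). Qed.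
Let ca w : U w -> {for w, continuous a}.
Proof. by case/Q1. Qed.
Let cb w : U w -> {for w, continuous b}.
Proof. by case/Q1. Qed.

Let snd_cos (w : R * R) : {for w, continuous (fun w : R * R => cos w.2)}.
Proof.
by apply: (@continuous_comp _ _ _ snd cos); [exact: cvg_snd|exact: continuous_cos].
Qed.
Let snd_sin (w : R * R) : {for w, continuous (fun w : R * R => sin w.2)}.
Proof.
by apply: (@continuous_comp _ _ _ snd sin); [exact: cvg_snd|exact: continuous_sin].
Qed.

(** The outward flux of the vector field (p, q) through the circle, divided by the circumference;
    the integrand is the real part of (p + i q) e^(-it). *)
Let flux (s : R) := cmean (fun t =>
  p (circle_pt z s t) * cos t + q (circle_pt z s t) * sin t).

(** The radial derivatives are a cos t - b sin t for p and b cos t + a sin t for q; after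
    multiplication by cos t and sin t they add up to a. *)
Let is_derive_flux (s : R) : - r < s < r ->
  is_derive s 1 flux (cmean (fun t => a (circle_pt z s t))).
Proof.
move=> sr.
apply: (@is_derive_cmean R (fun s t =>
  p (circle_pt z s t) * cos t + q (circle_pt z s t) * sin t)
  (fun s t => a (circle_pt z s t)) (- r) r s sr).
- move=> s' t sr'; apply: continuousDR; apply: continuousMR;
    by [exact: snd_cos|exact: snd_sin|exact: (continuous_circle2 cp sr')|
        exact: (continuous_circle2 cq sr')].
- by move=> s' t sr'; exact: (continuous_circle2 ca sr').
- move=> s' t sr'.
  have dp := is_derive_circle_radius oU P1 (Uc t sr').
  have dq := is_derive_circle_radius oU Q1 (Uc t sr').
  apply: is_deriveDR (is_deriveMR dp (is_derive_cstR _ _) erefl)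
    (is_deriveMR dq (is_derive_cstR _ _) erefl) _.
  rewrite !mulr0 !addr0; set c := circle_pt z s' t.
  transitivity (a c * (cos t ^+ 2 + sin t ^+ 2)); first by ring.
  by rewrite cos2Dsin2 mulr1.
Qed.

(** The difference of the integrands is the derivative in t of q cos t - p sin t, which takes the
    same value at 0 and at 2 pi. *)
Let flux_radius (s : R) : - r < s < r ->
  s * cmean (fun t => a (circle_pt z s t)) = flux s.
Proof.
move=> sr.
have cA := continuous_circle1 ca sr.
have cF : continuous (fun t : R =>
    p (circle_pt z s t) * cos t + q (circle_pt z s t) * sin t).
  apply: for_continuous => t; apply: continuousDR; apply: continuousMR;
    by [exact: continuous_cos|exact: continuous_sin|exact: (continuous_circle1 cp sr)|
        exact: (continuous_circle1 cq sr)].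
have csA : continuous (fun t : R => s * a (circle_pt z s t)).
  by apply: for_continuous => t; apply: continuousMR; [exact: cvg_cst|exact: cA].
have cD : continuous (fun t : R => s * a (circle_pt z s t) -
    (p (circle_pt z s t) * cos t + q (circle_pt z s t) * sin t)).
  by apply: for_continuous => t; apply: continuousBR; [exact: csA|exact: cF].
apply/eqP; rewrite -subr_eq0 -cmeanZ// -cmeanB//.
have dD (t : R) : 0 <= t <= 2 * pi -> is_derive t 1
    (fun t => q (circle_pt z s t) * cos t - p (circle_pt z s t) * sin t)
    (s * a (circle_pt z s t) -
      (p (circle_pt z s t) * cos t + q (circle_pt z s t) * sin t)).
  move=> _.
  have dp := is_derive_circle_angle oU P1 (Uc t sr).
  have dq := is_derive_circle_angle oU Q1 (Uc t sr).
  apply: is_deriveBR (is_deriveMR dq (is_derive_cos _) erefl)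
    (is_deriveMR dp (is_derive_sin _) erefl) _.
  set c := circle_pt z s t.
  transitivity (s * a c * (cos t ^+ 2 + sin t ^+ 2) - (p c * cos t + q c * sin t)).
    by ring.
  by rewrite cos2Dsin2 mulr1.
rewrite (cmean_is_derive cD dD).
by rewrite circle_pt_2pi mulr_natl cos2pi sin2pi cos0 sin0 subrr mulr0.
Qed.

(* The real part of Cauchy's formula for the derivative at the center. *)
Lemma holomorphic_derivative_mean (s : R) : 0 < s < r ->
  s * a z = cmean (fun t =>
    p (circle_pt z s t) * cos t + q (circle_pt z s t) * sin t).
Proof.
pose k s := cmean (fun t => a (circle_pt z s t)).
have I (x : R) : 0 <= x < r -> - r < x < r.
  by move=> /andP[x0 ->]; rewrite (lt_le_trans _ x0)// oppr_lt0.
move=> /andP[s0 sr]; rewrite -/(flux s) -flux_radius; last by rewrite I// ltW.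
congr (_ * _).
have kc : {for 0, continuous k}.
  apply: (@cmean_continuous R R (fun s t => a (circle_pt z s t)) [set x | - r < x < r]).
  - rewrite (_ : [set x | _] = `](- r), r[%classic); first exact: interval_open.
    by apply/seteqP; split => x /=; rewrite in_itv.
  - by move=> x t xr; exact: (continuous_circle2 ca xr).
  - by apply: I; rewrite lexx.
(* Together, [is_derive_flux] and [flux_radius] say that y flux' = flux. Hence flux y / y, which is
   [k y], is constant for y > 0, and continuity at 0 identifies the constant as [a z]. *)
have kE (x : R) : 0 < x -> x <= s -> k x = k s.
  move=> x0 xs.
  have xr y : x <= y -> y <= s -> - r < y < r.
    by move=> xy ys; apply: I; rewrite (le_trans (ltW x0) xy) (le_lt_trans ys).
  have dk y : x <= y -> y <= s -> is_derive y 1 (fun y => flux y / y) 0.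
    move=> xy ys; have y0 : y != 0 by rewrite gt_eqF// (lt_le_trans x0).
    have dV := is_deriveV y0 (is_derive_idR y).
    apply: is_deriveMR (is_derive_flux (xr _ xy ys)) dV _.
    rewrite -flux_radius ?xr// /GRing.scale/=; field.
    exact: y0.
  have [||c _] := @MVT_segment _ (fun y => flux y / y) (fun=> 0) x s xs.
  - by move=> y; rewrite in_itv/= => /andP[xy ys]; apply: dk; exact: ltW.
  - apply: derivable_within_continuous => y; rewrite in_itv/= => /andP[xy ys].
    by case: (dk y xy ys).
  rewrite mul0r => /eqP; rewrite subr_eq0 => /eqP.
  rewrite -!flux_radius ?xr// -/(k s) -/(k x).
  by rewrite !(mulrAC _ (k _)) !mulfV ?mul1r ?gt_eqF.
rewrite -/(k s); suff -> : k s = k 0.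
  by rewrite /k -[LHS]cmean_cst; apply: eq_cmean => t; rewrite circle_pt0.
apply/eqP; rewrite -subr_eq0 -normr_le0; apply/ler_addgt0Pl => e e0; rewrite addr0.
move/cvgrPdist_le : kc => /(_ e e0)/nbhs_ballP[d /= d0 dP].
have m0 : 0 < Num.min (d / 2) s by rewrite lt_min divr_gt0.
have := dP (Num.min (d / 2) s).
rewrite /ball/= sub0r normrN gtr0_norm// distrC kE ?ge_min ?lexx ?orbT//; apply.
by rewrite gt_min ltr_pdivrMr// ltr_pMr// ltr1n.
Qed.

(** By the Cauchy-Riemann equations in polar form, s times the radial derivative of p is the angular
    derivative of q, which has mean 0. So the circle mean of p is independent of s > 0, and at s = 0
    it is [p z]. *)
Lemma holomorphic_mean (s : R) : 0 < s < r ->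
  p z = cmean (fun t => p (circle_pt z s t)).
Proof.
move=> /andP[s0 sr].
have I (x : R) : 0 <= x <= s -> - r < x < r.
  by move=> /andP[x0 xs]; rewrite (lt_le_trans _ x0) ?oppr_lt0// (le_lt_trans xs).
pose m s := cmean (fun t => p (circle_pt z s t)).
pose dm s := cmean (fun t => a (circle_pt z s t) * cos t - b (circle_pt z s t) * sin t).
have dmE (x : R) : 0 <= x <= s -> is_derive x 1 m (dm x).
  move=> /I xr.
  apply: (@is_derive_cmean R (fun s t => p (circle_pt z s t))
    (fun s t => a (circle_pt z s t) * cos t - b (circle_pt z s t) * sin t) (- r) r x xr).
  - by move=> s' t sr'; exact: (continuous_circle2 cp sr').
  - move=> s' t sr'; apply: continuousBR; apply: continuousMR;
    by [exact: snd_cos|exact: snd_sin|exact: (continuous_circle2 ca sr')|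
        exact: (continuous_circle2 cb sr')].
  - move=> s' t sr'; have dp := is_derive_circle_radius oU P1 (Uc t sr').
    by apply: is_derive_eq dp _; rewrite mulNr.
have dm0 (x : R) : 0 < x -> x <= s -> dm x = 0.
  move=> x0 xs; have xr : - r < x < r by rewrite I// ltW.
  have cD : continuous (fun t : R =>
      a (circle_pt z x t) * cos t - b (circle_pt z x t) * sin t).
    apply: for_continuous => t; apply: continuousBR; apply: continuousMR;
    by [exact: continuous_cos|exact: continuous_sin|exact: (continuous_circle1 ca xr)|
        exact: (continuous_circle1 cb xr)].
  have cD' : continuous (fun t : R =>
      x * (a (circle_pt z x t) * cos t - b (circle_pt z x t) * sin t)).
    by apply: for_continuous => t; apply: continuousMR; [exact: cvg_cst|exact: cD].
  apply: (mulfI (x := x)); first by rewrite gt_eqF.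
  rewrite mulr0 -cmeanZ//.
  have dD (t : R) : 0 <= t <= 2 * pi -> is_derive t 1 (fun t => q (circle_pt z x t))
      (x * (a (circle_pt z x t) * cos t - b (circle_pt z x t) * sin t)).
    move=> _; have dq := is_derive_circle_angle oU Q1 (Uc t xr).
    by apply: is_derive_eq dq _; ring.
  by rewrite (cmean_is_derive cD' dD) circle_pt_2pi subrr mulr0.
have [||c] := @MVT_segment _ m (fun=> 0) 0 s (ltW s0).
- move=> x; rewrite in_itv/= => /andP[x0 xs].
  by rewrite -(dm0 x x0 (ltW xs)); apply: dmE; rewrite !ltW.
- apply: derivable_within_continuous => x; rewrite in_itv/= => xs.
  by case: (dmE x xs).
move=> _ /eqP; rewrite mul0r subr_eq0 => /eqP; rewrite -/(m s) => ->.
by rewrite /m -[LHS]cmean_cst; apply: eq_cmean => t; rewrite circle_pt0.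
Qed.

End Disc.

End Holomorphic.

(** * Harmonic functions *)

Section HarmonicComposition.
Variable R : realType.
Local Notation plane := (R * R)%type.
Implicit Types (f p q a b : plane -> R) (U V : set plane) (z : plane).

Lemma continuous_eq_on (T : topologicalType) (f g : T -> R) (A : set T) (z : T) :
  open A -> A z -> (forall w, A w -> f w = g w) ->
  {for z, continuous f} -> {for z, continuous g}.
Proof.
move=> oA Az fg cf; rewrite /prop_for /continuous_at -fg//.
apply: cvg_trans cf; apply: near_eq_cvg.
by apply: filterS (open_nbhs_nbhs (conj oA Az)) => w /fg.
Qed.

Lemma hasC1_eq_on U f fx fy g gx gy : open U -> (forall z, U z -> f z = g z) ->
  (forall z, U z -> fx z = gx z) -> (forall z, U z -> fy z = gy z) ->
  hasC1 U f fx fy -> hasC1 U g gx gy.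
Proof.
move=> oU fg fgx fgy H z Uz; have [dx dy cx cy] := H z Uz.
have nU : \forall w \near z, f w = g w.
  by apply: filterS (open_nbhs_nbhs (conj oU Uz)) => w /fg.
rewrite -fgx// -fgy//; split.
- exact: near_eq_is_derive dx.
- exact: near_eq_is_derive dy.
- exact: continuous_eq_on oU Uz fgx cx.
- exact: continuous_eq_on oU Uz fgy cy.
Qed.

Lemma hasC1D U f fx fy g gx gy : hasC1 U f fx fy -> hasC1 U g gx gy ->
  hasC1 U (fun z => f z + g z) (fun z => fx z + gx z) (fun z => fy z + gy z).
Proof.
move=> F G z Uz; have [dx dy cx cy] := F z Uz; have [ex ey kx ky] := G z Uz.
split; [exact: (is_deriveD dx ex)|exact: (is_deriveD dy ey)| |];
  exact: continuousDR.
Qed.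

Lemma hasC1Z U f fx fy (k : R) : hasC1 U f fx fy ->
  hasC1 U (fun z => k * f z) (fun z => k * fx z) (fun z => k * fy z).
Proof.
move=> F z Uz; have [dx dy cx cy] := F z Uz.
split; [exact: (is_deriveZ k dx)|exact: (is_deriveZ k dy)| |];
  by apply: continuousMR => //; exact: cvg_cst.
Qed.

Lemma hasC1M U f fx fy g gx gy : open U ->
  hasC1 U f fx fy -> hasC1 U g gx gy ->
  hasC1 U (fun z => f z * g z) (fun z => fx z * g z + f z * gx z)
    (fun z => fy z * g z + f z * gy z).
Proof.
move=> oU F G z Uz; have [dx dy cx cy] := F z Uz; have [ex ey kx ky] := G z Uz.
have cf := hasC1_continuous oU F Uz; have cg := hasC1_continuous oU G Uz.
split.
- apply: is_derive_eq (is_deriveM dx ex) _.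
  by rewrite addrC; congr (_ + _); exact: mulrC.
- apply: is_derive_eq (is_deriveM dy ey) _.
  by rewrite addrC; congr (_ + _); exact: mulrC.
- by apply: continuousDR; exact: continuousMR.
- by apply: continuousDR; exact: continuousMR.
Qed.

Lemma hasC1_C1_on U f fx fy : open U -> hasC1 U f fx fy -> C1_on U f.
Proof.
move=> oU F; split.
- by move=> z Uz; have [[dx _] [dy _] _ _] := F z Uz.
- rewrite continuous_open_subspace// => z; rewrite inE => Uz.
  have [_ _ cx _] := F z Uz; apply: continuous_eq_on oU Uz _ cx => w Uw.
  by have [[_ <-]] := F w Uw.
- rewrite continuous_open_subspace// => z; rewrite inE => Uz.
  have [_ _ _ cy] := F z Uz; apply: continuous_eq_on oU Uz _ cy => w Uw.
  by have [_ [_ <-]] := F w Uw.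
Qed.

Lemma C1_on_hasC1 U f : open U -> C1_on U f ->
  hasC1 U f (partial_x f) (partial_y f).
Proof.
move=> oU [df cx cy] z Uz; have [dx dy] := df z Uz.
have E (h : plane -> R) : {within U, continuous h} -> {for z, continuous h}.
  by rewrite (continuous_open_subspace h oU) => /(_ z (mem_set Uz)).
by split; [exact: derivableP|exact: derivableP|exact: E|exact: E].
Qed.

Lemma hasC1_partial U f fx fy z : hasC1 U f fx fy -> U z ->
  partial_x f z = fx z /\ partial_y f z = fy z.
Proof. by move=> F Uz; have [[_ <-] [_ <-]] := F z Uz. Qed.

(** The radius is fixed and the center moves, so that the derivatives fall on f alone. The weights k
    to come are cos and sin, from the mean formula for g'. *)
Lemma hasC1_cmean U V f fx fy (s : R) (k : R -> R) : open U -> open V ->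
  continuous k -> (forall z t, V z -> U (circle_pt z s t)) ->
  hasC1 U f fx fy ->
  hasC1 V (fun z => cmean (fun t => f (circle_pt z s t) * k t))
    (fun z => cmean (fun t => fx (circle_pt z s t) * k t))
    (fun z => cmean (fun t => fy (circle_pt z s t) * k t)).
Proof.
move=> oU oV ck VU F.
have cf z : U z -> {for z, continuous f} by exact: (hasC1_continuous oU F).
have cfx z : U z -> {for z, continuous fx} by case/F.
have cfy z : U z -> {for z, continuous fy} by case/F.
have J (T : topologicalType) (c : T -> plane) (h : plane -> R) (w : T * R) :
    (forall z, U z -> {for z, continuous h}) -> V (c w.1) ->
    {for w.1, continuous c} ->
    {for w, continuous (fun w : T * R => h (circle_pt (c w.1) s w.2) * k w.2)}.
  move=> ch Vz cc; apply: continuousMR.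
    apply: (@continuous_comp _ _ _ (fun w : T * R => circle_pt (c w.1) s w.2) h).
      apply: continuous_circle_pt; [|exact: cvg_cst|exact: cvg_snd].
      by apply: (@continuous_comp _ _ _ (fst : T * R -> T) c); first exact: cvg_fst.
    exact/ch/VU.
  by apply: (@continuous_comp _ _ _ (snd : T * R -> R) k);
    [exact: cvg_snd|exact: ck].
have JC (h : plane -> R) : (forall z, U z -> {for z, continuous h}) -> forall z, V z ->
    {for z, continuous (fun z => cmean (fun t => h (circle_pt z s t) * k t))}.
  move=> ch; apply: (@cmean_continuous R plane (fun z t => h (circle_pt z s t) * k t) V oV).
  move=> z t Vz; exact: (J plane id h (z, t) ch Vz (@cvg_id _ (nbhs z))).
move=> z Vz.
have /nbhs_ballP[d /= d0 dV] := open_nbhs_nbhs (conj oV Vz).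
have d00 : `|z.1 - z.1| < d by rewrite subrr normr0.
have d01 : `|z.2 - z.2| < d by rewrite subrr normr0.
split; [| |exact: JC|exact: JC].
- apply/is_derive_xE.
  have zV (x : R) : z.1 - d < x < z.1 + d -> V (x, z.2).
    by move=> h; apply: dV; split; [rewrite /ball/= ltr_distlC|exact: d01].
  apply: (@is_derive_cmean R (fun x t => f (circle_pt (x, z.2) s t) * k t)
    (fun x t => fx (circle_pt (x, z.2) s t) * k t) (z.1 - d) (z.1 + d)).
  + by rewrite ltrBlDr !ltrDl d0.
  + move=> x t /zV xV; apply: (J R (fun x => (x, z.2)) f (x, t)) => //.
    by apply: continuous_pair; [exact: cvg_id|exact: cvg_cst].
  + move=> x t /zV xV; apply: (J R (fun x => (x, z.2)) fx (x, t)) => //.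
    by apply: continuous_pair; [exact: cvg_id|exact: cvg_cst].
  + move=> x t /zV xV; have Uc := VU _ t xV.
    have dx : is_derive x 1 (fun x : R => x + s * cos t) 1.
      exact: is_deriveDR (is_derive_idR x) (is_derive_cstR (s * cos t) x) (addr0 _).
    have D := @is_derive_curve R U f fx fy (fun x : R => x + s * cos t)
      (fun=> z.2 + s * sin t) x 1 0 oU F Uc dx (is_derive_cstR _ x).
    apply: is_deriveMR D (is_derive_cstR (k t) _) _.
    by rewrite !mulr0 !addr0 mulr1.
- apply/is_derive_yE.
  have zV (x : R) : z.2 - d < x < z.2 + d -> V (z.1, x).
    by move=> h; apply: dV; split; [exact: d00|rewrite /ball/= ltr_distlC].
  apply: (@is_derive_cmean R (fun x t => f (circle_pt (z.1, x) s t) * k t)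
    (fun x t => fy (circle_pt (z.1, x) s t) * k t) (z.2 - d) (z.2 + d)).
  + by rewrite ltrBlDr !ltrDl d0.
  + move=> x t /zV xV; apply: (J R (fun x => (z.1, x)) f (x, t)) => //.
    by apply: continuous_pair; [exact: cvg_cst|exact: cvg_id].
  + move=> x t /zV xV; apply: (J R (fun x => (z.1, x)) fy (x, t)) => //.
    by apply: continuous_pair; [exact: cvg_cst|exact: cvg_id].
  + move=> x t /zV xV; have Uc := VU _ t xV.
    have dy : is_derive x 1 (fun x : R => x + s * sin t) 1.
      exact: is_deriveDR (is_derive_idR x) (is_derive_cstR (s * sin t) x) (addr0 _).
    have D := @is_derive_curve R U f fx fy (fun=> z.1 + s * cos t)
      (fun x : R => x + s * sin t) x 0 1 oU F Uc (is_derive_cstR _ x) dy.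
    apply: is_deriveMR D (is_derive_cstR (k t) _) _.
    by rewrite !mulr0 addr0 add0r mulr1.
Qed.

Lemma closed_disc_le z (r : R) w : 0 <= r -> closed_disc z r w ->
  `|w.1 - z.1| <= r /\ `|w.2 - z.2| <= r.
Proof.
move=> r0; rewrite /closed_disc/= => H.
have h (x y : R) : x ^+ 2 + y ^+ 2 <= r ^+ 2 -> `|x| <= r.
  move=> xy; rewrite -(@ler_pXn2r _ 2%N)// ?nnegrE// real_normK ?num_real//.
  by rewrite (le_trans _ xy)// lerDl sqr_ge0.
by split; [exact: h H|rewrite addrC in H; exact: h H].
Qed.

(** One radius has to serve all centers near z: circle means of that fixed radius can then be
    differentiated in the center. *)
Lemma nbhs_closed_disc U z : open U -> U z -> exists2 r, 0 < r &
  \forall w \near z, closed_disc w r `<=` U.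
Proof.
move=> oU Uz; have /nbhs_ballP[d /= d0 dU] := open_nbhs_nbhs (conj oU Uz).
have d2 : 0 < d / 2 by rewrite divr_gt0.
exists (d / 4); first by rewrite divr_gt0.
near=> w.
have [b1 b2] : ball z (d / 2) w by near: w; exact: (nbhsx_ballx z _ d2).
move=> v /closed_disc_le[|h1 h2]; first by rewrite divr_ge0// ltW.
rewrite /ball/= in b1 b2.
apply: dU; split; rewrite /ball/=.
  rewrite -(subrKA w.1) (le_lt_trans (ler_normD _ _))//.
  rewrite distrC in h1; lra.
rewrite -(subrKA w.2) (le_lt_trans (ler_normD _ _))//.
rewrite distrC in h2; lra.
Unshelve. all: by end_near. Qed.

Lemma holomorphic_derivative U p q a b : open U -> holomorphic U p q a b ->
  holomorphic U a b (partial_x a) (partial_x b).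
Proof.
move=> oU hU.
(* The admissible radius depends on z0, so the claim is proved locally. The local derivatives [a2]
   and [b2] agree with the partial derivatives of a and b, hence they glue. *)
suff L z0 : U z0 -> exists V a2 b2, [/\ open V, V z0 & holomorphic V a b a2 b2].
  have D z0 : U z0 -> [/\ is_derive z0 ((1, 0) : plane) a (partial_x a z0),
      is_derive z0 ((0, 1) : plane) a (- partial_x b z0),
      is_derive z0 ((1, 0) : plane) b (partial_x b z0),
      is_derive z0 ((0, 1) : plane) b (partial_x a z0) &
      {for z0, continuous (partial_x a)} /\ {for z0, continuous (partial_x b)}].
    move=> Uz0; have [V [a2 [b2 [oV Vz [A B]]]]] := L z0 Uz0.
    have E w : V w -> a2 w = partial_x a w /\ b2 w = partial_x b w.
      by move=> Vw; have [-> _] := hasC1_partial A Vw;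
        have [-> _] := hasC1_partial B Vw.
    have [ax ay ca2 _] := A _ Vz; have [bx by' cb2 _] := B _ Vz.
    have [<- <-] := E _ Vz; split => //; split.
      by apply: continuous_eq_on oV Vz _ ca2 => w /E[].
    by apply: continuous_eq_on oV Vz _ cb2 => w /E[].
  split=> z Uz; have [h1 h2 h3 h4 [h5 h6]] := D z Uz; split => //.
  by apply: (@continuousN R R^o); exact: h6.
move=> Uz0; have [r r0 nV] := nbhs_closed_disc oU Uz0.
have [V oV [Vz0 VU]] : exists2 V, open V & V z0 /\ forall w, V w -> closed_disc w r `<=` U.
  exists [set w | closed_disc w r `<=` U]^°; first exact: open_interior.
  by split => // w /interior_subset.
have [P Q] := hU.
pose s := r / 2.
have sr : 0 < s < r by rewrite /s divr_gt0//= ltr_pdivrMr// ltr_pMr// ltr1n.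
have s0 : 0 < s by case/andP: sr.
have sn0 : s != 0 by rewrite gt_eqF.
have Vc z t : V z -> U (circle_pt z s t).
  move=> Vz; apply: (VU z Vz); apply: circle_pt_disc.
  by rewrite ger0_norm ltW//; case/andP: sr.
have cc z (f : plane -> R) : V z -> (forall w, U w -> {for w, continuous f}) ->
    continuous (fun t : R => f (circle_pt z s t)).
  move=> Vz cf; apply: (continuous_circle1 (U := U) (r := r)) => //.
    exact: VU.
  by case/andP: sr => s1 ->; rewrite (lt_trans _ s1)// oppr_lt0.
have cp w : U w -> {for w, continuous p} by exact: (hasC1_continuous oU P).
have cq w : U w -> {for w, continuous q} by exact: (hasC1_continuous oU Q).
have ca w : U w -> {for w, continuous a} by case/Q.
have cb w : U w -> {for w, continuous b} by case/Q.
have cM z (f : plane -> R) (k : R -> R) : V z -> (forall w, U w -> {for w, continuous f}) ->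
    continuous k -> continuous (fun t : R => f (circle_pt z s t) * k t).
  move=> Vz cf ck; apply: for_continuous => t; apply: continuousMR.
    exact: (cc z f Vz cf).
  exact: ck.
have ccos := @continuous_cos R; have csin := @continuous_sin R.
have aE z : V z -> s^-1 * (cmean (fun t => p (circle_pt z s t) * cos t) +
    cmean (fun t => q (circle_pt z s t) * sin t)) = a z.
  move=> Vz; rewrite -cmeanD; [|exact: cM|exact: cM].
  by rewrite -(holomorphic_derivative_mean oU hU r0 (VU z Vz) sr) mulKf.
(* This is the formula for a, applied to - i (p + i q), whose derivative has real part b. *)
have bE z : V z -> s^-1 * (cmean (fun t => q (circle_pt z s t) * cos t) +
    -1 * cmean (fun t => p (circle_pt z s t) * sin t)) = b z.
  move=> Vz; rewrite -cmeanZ; last exact: cM.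
  rewrite -cmeanD; [|exact: cM|]; last first.
    by apply: for_continuous => t; apply: continuousMR; [exact: cvg_cst|exact: cM].
  rewrite -(mulKf sn0 (b z)); congr (_ * _).
  rewrite (holomorphic_derivative_mean oU (holomorphic_rot hU) r0 (VU z Vz) sr).
  by apply: eq_cmean => t; rewrite mulN1r mulNr.
have HC f fx fy k : continuous k -> hasC1 U f fx fy -> hasC1 V
    (fun z => cmean (fun t => f (circle_pt z s t) * k t))
    (fun z => cmean (fun t => fx (circle_pt z s t) * k t))
    (fun z => cmean (fun t => fy (circle_pt z s t) * k t)).
  by move=> ck; exact: hasC1_cmean.
have A := hasC1Z s^-1 (hasC1D (HC _ _ _ _ ccos P) (HC _ _ _ _ csin Q)).
have B := hasC1Z s^-1 (hasC1D (HC _ _ _ _ ccos Q) (hasC1Z (-1) (HC _ _ _ _ csin P))).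
have NE z k : V z -> continuous k ->
    cmean (fun t => - b (circle_pt z s t) * k t) =
    - cmean (fun t => b (circle_pt z s t) * k t).
  move=> Vz ck; rewrite -[RHS]mulN1r -cmeanZ; last exact: cM.
  by apply: eq_cmean => t; rewrite mulN1r mulNr.
(* Differentiating the mean formulas in x turns p, q into a, b, so g'' is given by the same formulas
   with g' in place of g. Differentiating in y brings in - b and a, which yields the Cauchy-Riemann
   equations for g'. *)
exists V, (fun z => s^-1 * (cmean (fun t => a (circle_pt z s t) * cos t) +
  cmean (fun t => b (circle_pt z s t) * sin t))),
  (fun z => s^-1 * (cmean (fun t => b (circle_pt z s t) * cos t) +
  -1 * cmean (fun t => a (circle_pt z s t) * sin t))); split => //; split.
  apply: hasC1_eq_on oV aE _ _ A => [z Vz|z Vz]; first by [].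
  by rewrite NE// -[RHS]mulrN opprD mulN1r opprK.
apply: hasC1_eq_on oV bE _ _ B => [z Vz|z Vz]; first by [].
by rewrite NE// mulN1r opprK.
Qed.

(** The laplacian of the composition is (a^2 + b^2) times the laplacian of w at g: by the
    Cauchy-Riemann equations for g and for g', the mixed derivatives of w and the terms containing
    g'' cancel between the two second derivatives. *)
Lemma harmonic_on_comp U V (w : plane -> \bar R) p q a b :
  open U -> open V -> harmonic_on V w -> holomorphic U p q a b ->
  (forall z, U z -> V (p z, q z)) -> harmonic_on U (fun z => w (p z, q z)).
Proof.
move=> oU oV [wf [W W1 W2] W0] hU UV.
have hU' := holomorphic_derivative oU hU.
have [P Q] := hU; have [A B] := hU'.
set a2 := partial_x a in hU' A B; set b2 := partial_x b in hU' A B.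
set f := fine \o w in W W1 W2 W0 *.
have {}W := C1_on_hasC1 oV W; have {}W1 := C1_on_hasC1 oV W1.
have {}W2 := C1_on_hasC1 oV W2.
set f1 := partial_x f in W W1 *; set f2 := partial_y f in W W2 *.
have F := hasC1_comp oU oV W P Q UV.
have F1 := hasC1_comp oU oV W1 P Q UV.
have F2 := hasC1_comp oU oV W2 P Q UV.
have B' := hasC1Z (-1) B.
have Fx := hasC1D (hasC1M oU F1 A) (hasC1M oU F2 B).
have Fy := hasC1D (hasC1M oU F1 B') (hasC1M oU F2 A).
pose g := fine \o (fun z => w (p z, q z)).
have gx z : U z -> f1 (p z, q z) * a z + f2 (p z, q z) * b z = partial_x g z.
  by move=> Uz; have [-> _] := hasC1_partial F Uz.
have gy z : U z -> f1 (p z, q z) * (-1 * b z) + f2 (p z, q z) * a z = partial_y g z.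
  by move=> Uz; have [_ ->] := hasC1_partial F Uz; rewrite mulN1r.
have Gx := hasC1_eq_on oU gx (fun _ _ => erefl) (fun _ _ => erefl) Fx.
have Gy := hasC1_eq_on oU gy (fun _ _ => erefl) (fun _ _ => erefl) Fy.
split.
- by move=> z /UV/wf.
- split; [exact: hasC1_C1_on F|exact: hasC1_C1_on Gx|exact: hasC1_C1_on Gy].
- move=> z Uz; rewrite /laplacian.
  have [-> _] := hasC1_partial Gx Uz; have [_ ->] := hasC1_partial Gy Uz.
  have := W0 _ (UV z Uz); rewrite /laplacian -/f1 -/f2.
  set X := partial_x f1 _; set Y := partial_y f2 _ => XY.
  rewrite (_ : Y = - X); first by ring.
  by apply/eqP; rewrite -addr_eq0 addrC XY.
Qed.

End HarmonicComposition.

(** * Maximum principle by rotations *)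

Section RotationAverage.
Variable R : realType.
Local Notation plane := (R * R)%type.
Implicit Types (z a : plane) (v : plane -> R).

(** Euclidean, in contrast to the sup norm of R * R, and squared, so that it is a polynomial with
    explicit circle means. *)
Definition sqdist z w : R := (z.1 - w.1) ^+ 2 + (z.2 - w.2) ^+ 2.

Lemma sqdist_ge0 z w : 0 <= sqdist z w.
Proof. by rewrite addr_ge0 ?sqr_ge0. Qed.

Lemma sqdistxx z : sqdist z z = 0.
Proof. by rewrite /sqdist !subrr expr0n addr0. Qed.

Lemma closed_discE a (r : R) z : closed_disc a r z = (sqdist z a <= r ^+ 2) :> Prop.
Proof. by []. Qed.

Lemma continuous_sqdist a : continuous (fun z => sqdist z a).
Proof.
move=> z; rewrite /sqdist.
have c1 : {for z, continuous (fun w : plane => w.1 - a.1)}.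
  by apply: (@continuousBR R plane); [exact: cvg_fst|exact: cvg_cst].
have c2 : {for z, continuous (fun w : plane => w.2 - a.2)}.
  by apply: (@continuousBR R plane); [exact: cvg_snd|exact: cvg_cst].
by apply: (@continuousDR R plane); exact: (@continuousMR R plane).
Qed.

Lemma compact_closed_disc a (r : R) : 0 <= r -> compact (closed_disc a r).
Proof.
move=> r0.
apply: (@subclosed_compact _ _ (`[a.1 - r, a.1 + r] `*` `[a.2 - r, a.2 + r])).
- rewrite (_ : closed_disc a r = (fun z => sqdist z a) @^-1` [set x | x <= r ^+ 2]).
    by apply: closed_comp => [z _|]; [exact: continuous_sqdist|exact: closed_le].
  by [].
- by apply: compact_setX; exact: segment_compact.
- move=> z /(closed_disc_le r0)[]; rewrite !ler_distl => h1 h2.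
  by split; rewrite /= in_itv.
Qed.

Lemma polar (x y r : R) : 0 <= r -> x ^+ 2 + y ^+ 2 = r ^+ 2 ->
  exists2 t, 0 <= t <= 2 * pi & x = r * cos t /\ y = r * sin t.
Proof.
rewrite le_eqVlt => /orP[/eqP <-|r0 xy].
  rewrite expr0n /= => /eqP; rewrite paddr_eq0 ?sqr_ge0// !sqrf_eq0 => /andP[/eqP -> /eqP ->].
  by exists 0; [rewrite lexx ltW// pi2_gt0|rewrite !mul0r].
have rn0 : r != 0 by rewrite gt_eqF.
have I : -1 <= x / r <= 1.
  rewrite -ler_norml normrM normfV (ger0_norm (ltW r0)) ler_pdivrMr// mul1r.
  rewrite -(@ler_pXn2r _ 2%N)// ?nnegrE ?(ltW r0)// real_normK ?num_real//.
  by rewrite -xy lerDl sqr_ge0.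
have rK (u : R) : r * (u / r) = u by rewrite mulrCA mulfV ?mulr1.
have cE : cos (acos (x / r)) = x / r by rewrite acosK// in_itv.
have sE : sin (acos (x / r)) = `|y| / r.
  rewrite sin_acos// -[RHS]ger0_norm ?divr_ge0// 1?ltW// -sqrtr_sqr; congr Num.sqrt.
  rewrite !expr_div_n real_normK ?num_real//.
  by rewrite -(@mulfV _ (r ^+ 2)) ?expf_neq0// -mulrBl -xy addrC addKr.
have [y0|y0] := leP 0 y.
  exists (acos (x / r)).
    rewrite acos_ge0//= (le_trans (acos_lepi I))// mulr_natl mulr2n lerDl pi_ge0//.
  by rewrite cE sE ger0_norm// !rK.
exists (2 * pi - acos (x / r)).
  rewrite subr_ge0 gerBl acos_ge0// andbT (le_trans (acos_lepi I))//.
  by rewrite mulr_natl mulr2n lerDl pi_ge0.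
rewrite addrC cosD2pi_mul sinD2pi_mul cosN sinN cE sE ltr0_norm//.
by rewrite mulNr opprK !rK.
Qed.

Lemma cmean_cos : cmean (@cos R) = 0.
Proof.
rewrite (cmean_is_derive (@continuous_cos R) (fun t _ => is_derive_sin t)).
by rewrite mulr_natl sin2pi sin0 subrr mulr0.
Qed.

Lemma cmean_sin : cmean (@sin R) = 0.
Proof.
have E : @sin R = (fun t => - 1 * - sin t) by apply/funext => t; rewrite mulN1r opprK.
have cs : continuous (fun t : R => - sin t).
  by apply: for_continuous => t; apply: (@continuousN R R^o); exact: continuous_sin.
rewrite E cmeanZ//.
rewrite (cmean_is_derive cs (fun t _ => is_derive_cos t)).
by rewrite mulr_natl cos2pi cos0 subrr !mulr0.
Qed.

Definition rotation a (t : R) z : plane :=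
  (a.1 + (cos t * (z.1 - a.1) - sin t * (z.2 - a.2)),
   a.2 + (sin t * (z.1 - a.1) + cos t * (z.2 - a.2))).

(** Together with [cmean_shift], this identifies the circle mean of a rotated function with a circle
    mean of the function about the rotated center. *)
Lemma rotation_circle_pt a (t s r : R) z :
  rotation a t (circle_pt z r s) = circle_pt (rotation a t z) r (s + t).
Proof.
rewrite /rotation /circle_pt /= cosD sinD.
by apply/pair_equal_spec; split; ring.
Qed.

Lemma rotation_center a t : rotation a t a = a.
Proof. by rewrite /rotation !subrr !mulr0 subrr !addr0 -surjective_pairing. Qed.

Lemma sqdist_rotation a t z : sqdist (rotation a t z) a = sqdist z a.
Proof.
rewrite /sqdist /rotation /= !(addrC a.1) !(addrC a.2) !addrK.
transitivity ((cos t ^+ 2 + sin t ^+ 2) * ((z.1 - a.1) ^+ 2 + (z.2 - a.2) ^+ 2)).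
  by ring.
by rewrite cos2Dsin2 mul1r.
Qed.

Lemma continuous_rotation a t : continuous (rotation a t).
Proof.
move=> z; rewrite /rotation.
have c1 : {for z, continuous (fun w : plane => w.1 - a.1)}.
  by apply: (@continuousBR R plane); [exact: cvg_fst|exact: cvg_cst].
have c2 : {for z, continuous (fun w : plane => w.2 - a.2)}.
  by apply: (@continuousBR R plane); [exact: cvg_snd|exact: cvg_cst].
have M (k : R) f : {for z, continuous f} -> {for z, continuous (fun w : plane => k * f w)}.
  by move=> cf; apply: (@continuousMR R plane); first exact: cvg_cst.
apply: (@continuous_pair plane R R).
  apply: (@continuousDR R plane); first exact: cvg_cst.
  by apply: (@continuousBR R plane); exact: M.
apply: (@continuousDR R plane); first exact: cvg_cst.
by apply: (@continuousDR R plane); exact: M.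
Qed.

(** The surplus r^2 is what compensates an error o(s^2) in a mean inequality on circles of radius
    s. *)
Lemma cmean_sqdist_circle a z (r : R) :
  cmean (fun t => sqdist (circle_pt z r t) a) = sqdist z a + r ^+ 2.
Proof.
have E t : sqdist (circle_pt z r t) a = sqdist z a + r ^+ 2 +
    (2 * r * (z.1 - a.1) * cos t + 2 * r * (z.2 - a.2) * sin t).
  transitivity (sqdist z a + r ^+ 2 * (cos t ^+ 2 + sin t ^+ 2) +
    (2 * r * (z.1 - a.1) * cos t + 2 * r * (z.2 - a.2) * sin t)).
    by rewrite /sqdist /circle_pt /=; ring.
  by rewrite cos2Dsin2 mulr1.
have ccos := @continuous_cos R; have csin := @continuous_sin R.
have cM (k : R) f : continuous f -> continuous (fun t : R => k * f t).
  by move=> cf; apply: for_continuous => t; apply: continuousMR; [exact: cvg_cst|exact: cf].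
have cD f g : continuous f -> continuous g -> continuous (fun t : R => f t + g t :> R).
  by move=> cf cg; apply: for_continuous => t; apply: continuousDR; [exact: cf|exact: cg].
rewrite (eq_cmean E) cmeanD; [|by move=> ?; exact: cvg_cst|by apply: cD; exact: cM].
rewrite cmean_cst cmeanD; [|exact: cM|exact: cM].
by rewrite !cmeanZ// cmean_cos cmean_sin !mulr0 !addr0.
Qed.

(* V is the average of v over the rotations of order N about a, made strictly
   subharmonic by [e * sqdist _ a]; its maximum over the disc is attained on the
   boundary circle, where the average is a Riemann sum of the circle mean of v. *)
Lemma submean_of_asymptotic v U a (r : R) : open U -> 0 < r ->
  closed_disc a r `<=` U -> (forall z, U z -> {for z, continuous v}) ->
  (forall z, closed_disc a r z -> forall e, 0 < e -> \forall s \near 0^'+,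
     v z <= cmean (fun t => v (circle_pt z s t)) + e * s ^+ 2) ->
  v a <= cmean (fun t => v (circle_pt a r t)).
Proof.
move=> oU r0 aU cv asym.
set M := cmean _.
have r2 : 0 < 1 + r ^+ 2 by rewrite ltr_pwDl// sqr_ge0.
apply/ler_addgt0Pl => e' e'0; rewrite addrC.
(* The total loss is e for the Riemann sum plus e r^2 for the perturbation on the boundary
   circle. *)
pose e := e' / (1 + r ^+ 2).
have e0 : 0 < e by rewrite divr_gt0.
have -> : e' = e + e * r ^+ 2.
  by rewrite -[X in X + _]mulr1 -mulrDr /e divfK// gt_eqF.
have cvc z s : (forall t, U (circle_pt z s t)) ->
    continuous (fun t : R => v (circle_pt z s t)).
  move=> zU; apply: for_continuous => t.
  apply: (@continuous_comp _ _ _ (fun t => circle_pt z s t) v); last exact: cv.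
  by apply: continuous_circle_pt; [exact: cvg_cst|exact: cvg_cst|exact: cvg_id].
have arU t : U (circle_pt a r t).
  by apply/aU/circle_pt_disc; rewrite ger0_norm// ltW.
have [N N0 HN] := riemann_cmean (cvc a r arU) (fun t => congr1 v (circle_ptD2pi a r t)) e0.
have Nr0 : 0 < N%:R :> R by rewrite ltr0n.
pose th (k : 'I_N) : R := 2 * pi * k%:R / N%:R.
pose A z := N%:R^-1 * \sum_(k < N) v (rotation a (th k) z).
pose V z := A z + e * sqdist z a.
have rotD t z : closed_disc a r z -> closed_disc a r (rotation a t z).
  by rewrite !closed_discE sqdist_rotation.
have cV z : closed_disc a r z -> {for z, continuous V}.
  move=> Dz; apply: (@continuousDR R plane); apply: (@continuousMR R plane);
    try exact: cvg_cst; last exact: continuous_sqdist.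
  apply: (@for_continuous_sum R plane) => k.
  apply: (@continuous_comp _ _ _ (rotation a (th k)) v).
    exact: continuous_rotation.
  exact/cv/aU/rotD.
have Da : closed_disc a r a by rewrite closed_discE sqdistxx sqr_ge0.
have [z0 Dz0 maxV] : exists2 z0, closed_disc a r z0 &
    forall z, closed_disc a r z -> V z <= V z0.
  have [||z0] := @compact_EVT_max plane R V _ _ (@compact_closed_disc a r (ltW r0)).
  - by exists a.
  - by apply: continuous_in_subspaceT => z; rewrite inE; exact: cV.
  by rewrite inE => Dz0 H; exists z0 => // z Dz; apply: H; rewrite inE.
have vaV : v a <= V z0.
  apply: le_trans (maxV a Da).
  rewrite /V /A sqdistxx mulr0 addr0.
  under eq_bigr do rewrite rotation_center.
  rewrite sumr_const card_ord -[X in _ * X]mulr_natl mulrA mulVf ?mul1r//.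
  by rewrite gt_eqF.
have : sqdist z0 a <= r ^+ 2 by [].
rewrite le_eqVlt => /orP[/eqP z0r|z0r]; last first.
  (* At an interior maximum the circle means of V are at most [V z0]. But the perturbation gains e
     s^2, while the asymptotic inequality, taken with e / 2, loses at most half of it. *)
  exfalso.
  have oD : open [set z | sqdist z a < r ^+ 2].
    apply: (@open_comp _ _ (fun z => sqdist z a) [set x | x < r ^+ 2]) => [z _|].
      exact: continuous_sqdist.
    exact: open_lt.
  have [r1 r10 nD] := nbhs_closed_disc oD z0r.
  have {nD} z0D := nbhs_singleton nD.
  have e2 : 0 < e / 2 by rewrite divr_gt0.
  (* The asymptotic inequality comes with a threshold on s for each point; as there are finitely
     many rotated copies of z0, one s suits them all. *)
  have nr : \forall s \near (0:R)^'+, 0 < s < r1 /\ forall k : 'I_N,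
      v (rotation a (th k) z0) <=
      cmean (fun t => v (circle_pt (rotation a (th k) z0) s t)) + e / 2 * s ^+ 2.
    near=> s; split.
      apply/andP; split; near: s; [exact: nbhs_right_gt|exact: nbhs_right_lt].
    near: s; apply: filter_forall => k.
    by apply: asym => //; exact: rotD.
  have [s [/andP[s0 sr1] Hs]] := @filter_ex _ _ (at_right_proper_filter 0) _ nr.
  have cD t : closed_disc a r (circle_pt z0 s t).
    apply: ltW; apply: (z0D (circle_pt z0 s t)).
    by apply: circle_pt_disc; rewrite ger0_norm ltW.
  have cVc : continuous (fun t : R => V (circle_pt z0 s t)).
    apply: for_continuous => t.
    apply: (@continuous_comp _ _ _ (fun t => circle_pt z0 s t) V); last exact/cV/cD.
    by apply: continuous_circle_pt; [exact: cvg_cst|exact: cvg_cst|exact: cvg_id].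
  have crc k : continuous (fun t : R => v (rotation a (th k) (circle_pt z0 s t))).
    apply: for_continuous => t.
    apply: (@continuous_comp _ _ _ (fun t => circle_pt z0 s t) (v \o rotation a (th k))).
      by apply: continuous_circle_pt; [exact: cvg_cst|exact: cvg_cst|exact: cvg_id].
    apply: (@continuous_comp _ _ _ (rotation a (th k)) v).
      exact: continuous_rotation.
    exact/cv/aU/rotD/cD.
  have mV : cmean (fun t => V (circle_pt z0 s t)) <= V z0.
    rewrite -[leRHS](cmean_cst (V z0)); apply: le_cmean => //.
      by move=> ?; exact: cvg_cst.
    by move=> t _; exact/maxV/cD.
  have EV : cmean (fun t => V (circle_pt z0 s t)) =
      N%:R^-1 * (\sum_(k < N) cmean (fun t => v (circle_pt (rotation a (th k) z0) s t)))
      + e * (sqdist z0 a + s ^+ 2).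
    have csum : continuous (fun t : R => \sum_(k < N) v (rotation a (th k) (circle_pt z0 s t))).
      exact: continuous_sum.
    have csq : continuous (fun t : R => sqdist (circle_pt z0 s t) a).
      apply: for_continuous => t.
      apply: (@continuous_comp _ _ _ (fun t => circle_pt z0 s t) (fun z => sqdist z a)).
        by apply: continuous_circle_pt; [exact: cvg_cst|exact: cvg_cst|exact: cvg_id].
      exact: continuous_sqdist.
    rewrite cmeanD; last 2 first.
    - by apply: for_continuous => t; apply: continuousMR; [exact: cvg_cst|exact: csum].
    - by apply: for_continuous => t; apply: continuousMR; [exact: cvg_cst|exact: csq].
    rewrite !cmeanZ// cmean_sqdist_circle; congr (_ * _ + _).
    rewrite (cmean_sum _ crc).
    apply: eq_bigr => k _.
    under eq_cmean do rewrite rotation_circle_pt.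
    have cU t : U (circle_pt (rotation a (th k) z0) s t).
      rewrite -[t](subrK (th k)) -rotation_circle_pt; exact/aU/rotD/cD.
    apply: (cmean_shift _ (cvc _ _ cU)).
    by move=> t; rewrite circle_ptD2pi.
  have SA : A z0 <= N%:R^-1 *
      (\sum_(k < N) cmean (fun t => v (circle_pt (rotation a (th k) z0) s t)))
      + e / 2 * s ^+ 2.
    set S := \sum_(k < N) _.
    have -> : N%:R^-1 * S + e / 2 * s ^+ 2 =
        N%:R^-1 * (S + \sum_(k < N) (e / 2 * s ^+ 2)).
      rewrite sumr_const card_ord -(mulr_natl (e / 2 * s ^+ 2)) mulrDr; congr (_ + _).
      by rewrite mulKf// gt_eqF.
    rewrite /A ler_pM2l ?invr_gt0// -big_split/=.
    by apply: ler_sum => k _; exact: Hs.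
  have es : 0 < e / 2 * s ^+ 2 by rewrite mulr_gt0// exprn_gt0.
  move: mV; rewrite EV /V mulrDr addrA => mV.
  have : A z0 + e * sqdist z0 a < A z0 + e * sqdist z0 a by lra.
  by rewrite ltxx.
(* For z0 on the boundary circle, its N rotated copies are the nodes of the Riemann sum starting at
   the angle b of z0. *)
have [b b2 [b1 b2']] := polar (ltW r0) z0r.
have z0E : z0 = circle_pt a r b.
  by rewrite /circle_pt -b1 -b2' !(addrC a.1) !(addrC a.2) !subrK -surjective_pairing.
apply: (le_trans vaV); rewrite /V z0r addrA lerD// -lerBlDl.
apply: le_trans (ler_norm _) _; apply: le_trans (HN b b2).
rewrite /A; set X := \sum_(k < N) _; set Y := \sum_(k < N) _.
suff -> : X = Y by [].
by apply: eq_bigr => k _; rewrite z0E rotation_circle_pt rotation_center.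
Unshelve. all: by end_near. Qed.

End RotationAverage.

(** * Sup-convolutions *)

Section SupConvolution.
Variable R : realType.
Local Notation plane := (R * R)%type.
Implicit Types (z x y : plane) (W : plane -> R) (K U : set plane).

Lemma closed_disc_trans x y z (s t : R) : 0 <= s -> 0 <= t ->
  closed_disc x s y -> closed_disc y t z -> closed_disc x (s + t) z.
Proof.
move=> s0 t0; rewrite !closed_discE /sqdist.
set u1 := y.1 - x.1; set u2 := y.2 - x.2; set v1 := z.1 - y.1; set v2 := z.2 - y.2.
have -> : z.1 - x.1 = u1 + v1 by rewrite /u1 /v1; ring.
have -> : z.2 - x.2 = u2 + v2 by rewrite /u2 /v2; ring.
move=> us vt.
(* The Cauchy-Schwarz inequality, by Lagrange's identity. *)
have uv2 : (u1 * v1 + u2 * v2) ^+ 2 <= (s * t) ^+ 2.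
  rewrite exprMn; apply: (@le_trans _ _ ((u1 ^+ 2 + u2 ^+ 2) * (v1 ^+ 2 + v2 ^+ 2))).
    rewrite -subr_ge0 (_ : _ - _ = (u1 * v2 - u2 * v1) ^+ 2) ?sqr_ge0//; ring.
  by apply: ler_pM => //; rewrite addr_ge0 ?sqr_ge0.
have uv : u1 * v1 + u2 * v2 <= s * t.
  apply: le_trans (ler_norm _) _.
  by rewrite -(@ler_pXn2r _ 2%N)// ?nnegrE ?mulr_ge0// real_normK ?num_real.
have -> : (u1 + v1) ^+ 2 + (u2 + v2) ^+ 2 =
  (u1 ^+ 2 + u2 ^+ 2) + (v1 ^+ 2 + v2 ^+ 2) + 2 * (u1 * v1 + u2 * v2) by ring.
have -> : (s + t) ^+ 2 = s ^+ 2 + t ^+ 2 + 2 * (s * t) by ring.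
by rewrite lerD ?ler_pM2l// lerD.
Qed.

Lemma closed_discS x (s t : R) : 0 <= s <= t -> closed_disc x s `<=` closed_disc x t.
Proof.
move=> /andP[s0 st] y; rewrite !closed_discE => /le_trans; apply.
by rewrite ler_pXn2r// ?nnegrE// (le_trans s0).
Qed.

(** The negative of a Moreau envelope of - W, with competitors restricted to K. The real [sup] is
    meaningful when K is nonempty and W is bounded above on K. *)
Definition supconv W K (k : R) x : R :=
  sup [set W y - k * sqdist y x | y in K].

Section Bounded.
Variables (W : plane -> R) (K : set plane) (k B M : R).
Hypotheses (k0 : 0 <= k) (K0 : K !=set0).
Hypothesis KB : forall y, K y -> `|y.1| <= B /\ `|y.2| <= B.
Hypothesis WM : forall y, K y -> W y <= M.

Let has_supconv x : has_sup [set W y - k * sqdist y x | y in K].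
Proof.
split; first by case: K0 => y Ky; exists (W y - k * sqdist y x), y.
exists M => _ [y Ky <-]; rewrite (le_trans _ (WM Ky))// gerBl.
by rewrite mulr_ge0// sqdist_ge0.
Qed.

Lemma supconv_ge x y : K y -> W y - k * sqdist y x <= supconv W K k x.
Proof.
move=> Ky; apply: ub_le_sup; first by case: (has_supconv x).
by exists y.
Qed.

Lemma supconv_adherent x (e : R) : 0 < e ->
  exists2 y, K y & supconv W K k x - e < W y - k * sqdist y x.
Proof.
by move=> e0; have [_ [y Ky <-] ?] := sup_adherent e0 (has_supconv x); exists y.
Qed.

Lemma supconv_le x (c : R) : (forall y, K y -> W y - k * sqdist y x <= c) ->
  supconv W K k x <= c.
Proof.
move=> H; apply: ge_sup; first by case: (has_supconv x).
by move=> _ [y Ky <-]; exact: H.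
Qed.

(** On the bounded set K the penalties are Lipschitz near x with a constant independent of y, and a
    supremum inherits such a common modulus. *)
Lemma continuous_supconv : continuous (supconv W K k).
Proof.
move=> x.
have [B0] : exists y, K y by case: K0 => y Ky; exists y.
move=> /KB[+ _] => /(le_trans (normr_ge0 _)) Bge0.
(* This bounds |w - v + 2 v - 2 u|, the second factor of (u - w)^2 - (u - v)^2, for |u| <= B, v a
   coordinate of x and |w - v| <= 1. *)
pose C := 2 * B + 2 * (`|x.1| + `|x.2|) + 1.
have C0 : 0 < C by rewrite /C ltr_wpDl// addr_ge0 ?mulr_ge0// addr_ge0.
have sq (u v w : R) : `|u| <= B -> `|v| <= `|x.1| + `|x.2| -> `|w - v| <= 1 ->
    `|(u - w) ^+ 2 - (u - v) ^+ 2| <= C * `|w - v|.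
  move=> uB vx wv.
  have -> : (u - w) ^+ 2 - (u - v) ^+ 2 = (w - v) * ((w - v) + 2 * v - 2 * u) by ring.
  rewrite normrM mulrC ler_wpM2r// (le_trans (ler_normB _ _))//.
  rewrite normrM ger0_norm// /C; have := ler_normD (w - v) (2 * v).
  by rewrite normrM (ger0_norm (@ler0n _ 2)); lra.
have L y x' : K y -> `|x'.1 - x.1| <= 1 -> `|x'.2 - x.2| <= 1 ->
    `|k * sqdist y x' - k * sqdist y x| <= k * C * (`|x'.1 - x.1| + `|x'.2 - x.2|).
  move=> Ky h1 h2; have [y1 y2] := KB Ky.
  rewrite -mulrBr normrM ger0_norm// -mulrA ler_wpM2l// /sqdist opprD addrACA.
  rewrite (le_trans (ler_normD _ _))// mulrDr lerD// sq// ?lerDl ?lerDr//.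
apply/cvgrPdist_le => e e0.
pose d := Num.min 1 (e / (2 * (k * C + 1))).
have kC0 : 0 < k * C + 1 by rewrite ltr_wpDl// mulr_ge0// ltW.
have d0 : 0 < d by rewrite lt_min ltr01 divr_gt0// mulr_gt0.
near=> x'.
have [b1 b2] : ball x d x' by near: x'; exact: (nbhsx_ballx x _ d0).
have h1 : `|x'.1 - x.1| <= d by rewrite distrC ltW.
have h2 : `|x'.2 - x.2| <= d by rewrite distrC ltW.
have d1 : d <= 1 by rewrite ge_min lexx.
have dE : (k * C) * (d + d) <= e.
  apply: (@le_trans _ _ ((k * C + 1) * (d + d))).
    by rewrite ler_wpM2r ?addr_ge0 ?(ltW d0)// lerDl.
  have dd : d <= e / (2 * (k * C + 1)) by rewrite ge_min lexx orbT.
  apply: (@le_trans _ _ ((k * C + 1) * (e / (2 * (k * C + 1)) + e / (2 * (k * C + 1))))).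
    by rewrite ler_pM2l// lerD.
  by rewrite le_eqVlt; apply/orP; left; apply/eqP; field; rewrite gt_eqF.
have L' y : K y -> `|k * sqdist y x' - k * sqdist y x| <= e.
  move=> Ky; apply: le_trans (L y x' Ky (le_trans h1 d1) (le_trans h2 d1)) _.
  by apply: le_trans dE; rewrite ler_wpM2l ?mulr_ge0 ?(ltW C0)// lerD.
rewrite ler_norml; apply/andP; split.
  suff : supconv W K k x' <= supconv W K k x + e by lra.
  apply: supconv_le => y Ky.
  have := supconv_ge x Ky; have := L' y Ky; rewrite ler_norml => /andP[]; lra.
rewrite lerBlDr; apply: supconv_le => y Ky.
have := supconv_ge x' Ky; have := L' y Ky; rewrite ler_norml => /andP[]; lra.
Unshelve. all: by end_near. Qed.

End Bounded.

(* At a near-maximizer y of the sup-convolution at g(z0), moving y along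
   y + g'(z0) s when z0 moves to z0 + s changes the penalty only through the
   first-order Taylor remainder of g, whose mean over circles is 0 and whose
   square is o(s^2). *)
Lemma supconv_asymptotic U p q a b W K (k B M m d : R) z0 :
  open U -> holomorphic U p q a b -> U z0 ->
  (forall y, K y -> `|y.1| <= B /\ `|y.2| <= B) ->
  (forall y, K y -> m <= W y <= M) ->
  (forall y (s : R) (Q : R -> R), 0 <= s -> closed_disc y s `<=` K ->
    continuous Q -> (forall t, W (circle_pt y s t) <= Q t) -> W y <= cmean Q) ->
  0 < d -> closed_disc (p z0, q z0) d `<=` K -> 0 <= k ->
  M - m + 1 <= k * (d / 2) ^+ 2 ->
  forall e, 0 < e -> \forall s \near 0^'+,
    supconv W K k (p z0, q z0) <=
    cmean (fun t => supconv W K k (p (circle_pt z0 s t), q (circle_pt z0 s t))) +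
    e * s ^+ 2.
Proof.
move=> oU hU Uz0 KB WM SM d0 dK k0 kd e e0.
have [P Q] := hU.
set x0 := (p z0, q z0); set F := supconv W K k.
have Kx0 : K x0 by apply: dK; rewrite closed_discE sqdistxx sqr_ge0.
have K0 : K !=set0 by exists x0.
have WM' y : K y -> W y <= M by move=> /WM/andP[].
have kp : 0 < k.
  rewrite lt_neqAle k0 andbT eq_sym; apply/eqP => kE.
  have := kd; rewrite kE mul0r; have := WM _ Kx0; lra.
have [r r0 rU] : exists2 r, 0 < r & closed_disc z0 r `<=` U.
  by have [r r0 /nbhs_singleton] := nbhs_closed_disc oU Uz0; exists r.
pose c := Num.sqrt (a z0 ^+ 2 + b z0 ^+ 2).
have c0 : 0 <= c by exact: sqrtr_ge0.
have c2 : a z0 ^+ 2 + b z0 ^+ 2 = c ^+ 2 by rewrite sqr_sqrtr// addr_ge0 ?sqr_ge0.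
(* Polar form g'(z0) = c e^(i th): multiplication by g'(z0) maps the circle of radius s to the one
   of radius c s and shifts the angle by th. *)
have [th _ [aE bE]] := polar c0 c2.
(* Both remainders will be at most 2 e1 s, so the penalty error is at most 8 k e1^2 s^2. Since e1 <=
   1, e1^2 can be replaced by e1. *)
pose e1 := Num.min 1 (e / (8 * k)).
have e10 : 0 < e1 by rewrite lt_min ltr01 divr_gt0// mulr_gt0.
have e1k : k * (8 * e1 ^+ 2) <= e.
  have h1 : e1 ^+ 2 <= e1.
    by rewrite expr2 ger_pMl// ge_min lexx.
  have h2 : e1 <= e / (8 * k) by rewrite ge_min lexx orbT.
  apply: (@le_trans _ _ (k * (8 * (e / (8 * k))))).
    by rewrite ler_pM2l// ler_pM2l// (le_trans h1).
  by rewrite le_eqVlt; apply/orP; left; apply/eqP; field; rewrite gt_eqF.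
have AP := hasC1_approx oU P Uz0 e10; have AQ := hasC1_approx oU Q Uz0 e10.
have /nbhs_ballP[r1 /= r10 HA] : \forall z \near z0,
    `|p z - p z0 - a z0 * (z.1 - z0.1) - - b z0 * (z.2 - z0.2)| <=
       e1 * (`|z.1 - z0.1| + `|z.2 - z0.2|) /\
    `|q z - q z0 - b z0 * (z.1 - z0.1) - a z0 * (z.2 - z0.2)| <=
       e1 * (`|z.1 - z0.1| + `|z.2 - z0.2|).
  by near=> z; split; near: z.
have c1 : 0 < c + 1 by rewrite ltr_wpDl.
have d2c : 0 < d / 2 / (c + 1) by rewrite !divr_gt0.
near=> s.
have s0 : 0 < s by near: s; exact: nbhs_right_gt.
have sr : s < r by near: s; exact: nbhs_right_lt.
have sr1 : s < r1 by near: s; exact: nbhs_right_lt.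
have sd : c * s <= d / 2.
  have : s < d / 2 / (c + 1) by near: s; exact: (nbhs_right_lt d2c).
  by rewrite ltr_pdivlMr//; lra.
have Isr : - r < s < r by rewrite sr (lt_trans _ s0)// oppr_lt0.
pose C t := circle_pt z0 s t.
have CU t : U (C t).
  by apply/rU/circle_pt_disc; rewrite ger0_norm ltW.
(* The real and imaginary parts of the first-order remainder of g at z0, along the circle. *)
pose R1 t := p (C t) - p z0 - s * (a z0 * cos t - b z0 * sin t).
pose R2 t := q (C t) - q z0 - s * (b z0 * cos t + a z0 * sin t).
have CE t : ((C t).1 - z0.1 = s * cos t) * ((C t).2 - z0.2 = s * sin t).
  by rewrite /C /circle_pt /= !(addrC z0.1) !(addrC z0.2) !addrK.
have RB t : `|R1 t| <= e1 * (2 * s) /\ `|R2 t| <= e1 * (2 * s).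
  have cs : `|s * cos t| <= s.
    by rewrite normrM (gtr0_norm s0) ger_pMr// ler_norml cos_geN1 cos_le1.
  have ss : `|s * sin t| <= s.
    by rewrite normrM (gtr0_norm s0) ger_pMr// ler_norml sin_geN1 sin_le1.
  have [|h1 h2] := HA (C t).
    split; rewrite /ball/= distrC CE; exact: le_lt_trans sr1.
  rewrite !CE in h1 h2.
  have css : e1 * (`|s * cos t| + `|s * sin t|) <= e1 * (2 * s).
    by rewrite ler_pM2l//; lra.
  split.
    apply: le_trans css; apply: le_trans h1; rewrite le_eqVlt; apply/orP; left.
    by apply/eqP; congr `|_|; rewrite /R1; ring.
  apply: le_trans css; apply: le_trans h2; rewrite le_eqVlt; apply/orP; left.
  by apply/eqP; congr `|_|; rewrite /R2; ring.
have ccos := @continuous_cos R; have csin := @continuous_sin R.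
have cD (f g : R -> R) : continuous f -> continuous g -> continuous (fun t : R => f t + g t :> R).
  by move=> cf cg; apply: for_continuous => t; apply: continuousDR; [exact: cf|exact: cg].
have cB (f g : R -> R) : continuous f -> continuous g -> continuous (fun t : R => f t - g t :> R).
  by move=> cf cg; apply: for_continuous => t; apply: continuousBR; [exact: cf|exact: cg].
have cM (f g : R -> R) : continuous f -> continuous g -> continuous (fun t : R => f t * g t :> R).
  by move=> cf cg; apply: for_continuous => t; apply: continuousMR; [exact: cf|exact: cg].
have cc (x : R) : continuous (fun _ : R => x) by move=> ?; exact: cvg_cst.
have cp : continuous (fun t => p (C t)).
  by apply: (continuous_circle1 rU) => // z; exact: (hasC1_continuous oU P).
have cq : continuous (fun t => q (C t)).
  by apply: (continuous_circle1 rU) => // z; exact: (hasC1_continuous oU Q).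
have cR1 : continuous R1.
  by apply: (cB); [exact: (cB)|apply: (cM) => //; apply: (cB); exact: (cM)].
have cR2 : continuous R2.
  by apply: (cB); [exact: (cB)|apply: (cM) => //; apply: (cD); exact: (cM)].
have srr : 0 < s < r by rewrite s0.
(* The mean value property cancels p against [p z0], and the linear part has mean 0. *)
have mR1 : cmean R1 = 0.
  rewrite cmeanB; [|exact: (cB)|by apply: (cM) => //; apply: (cB); exact: (cM)].
  rewrite cmeanB// cmean_cst -(holomorphic_mean oU hU r0 rU srr) subrr sub0r.
  rewrite cmeanZ; last by apply: (cB); exact: (cM).
  rewrite cmeanB; [|exact: (cM)|exact: (cM)].
  by rewrite !cmeanZ// cmean_cos cmean_sin !mulr0 subrr mulr0 oppr0.
have mR2 : cmean R2 = 0.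
  rewrite cmeanB; [|exact: (cB)|by apply: (cM) => //; apply: (cD); exact: (cM)].
  rewrite cmeanB// cmean_cst -(holomorphic_mean oU (holomorphic_rot hU) r0 rU srr).
  rewrite subrr sub0r cmeanZ; last by apply: (cD); exact: (cM).
  rewrite cmeanD; [|exact: (cM)|exact: (cM)].
  by rewrite !cmeanZ// cmean_cos cmean_sin !mulr0 addr0 mulr0 oppr0.
have cF : continuous (fun t => F (p (C t), q (C t))).
  apply: for_continuous => t.
  apply: (@continuous_comp _ _ _ (fun t => (p (C t), q (C t))) F).
    by apply: continuous_pair; [exact: cp|exact: cq].
  exact: (continuous_supconv k0 K0 KB WM').
apply/ler_addgt0Pl => e2' e2'0.
pose e2 := Num.min 1 e2'.
have e20 : 0 < e2 by rewrite lt_min ltr01.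
have e21 : e2 <= 1 by rewrite ge_min lexx.
have e22 : e2 <= e2' by rewrite ge_min lexx orbT.
have [y Ky Hy] := supconv_adherent k0 K0 WM' x0 e20.
have Wx0 : m <= F x0.
  apply: le_trans (supconv_ge k0 K0 WM' x0 Kx0).
  by rewrite sqdistxx mulr0 subr0; case/andP: (WM _ Kx0).
(* The value at y is within e2 <= 1 of [F x0] >= m while [W y] <= M, so the penalty at y is at most
   M - m + 1. Hence the disc of radius c s <= d / 2 about y stays within distance d of x0. *)
have yx0 : sqdist y x0 <= (d / 2) ^+ 2.
  rewrite -(ler_pM2l kp); apply: le_trans kd.
  rewrite -/F in Hy; have := WM' _ Ky; lra.
have d20 : 0 <= d / 2 by rewrite divr_ge0// ltW.
have yK : closed_disc y (c * s) `<=` K.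
  move=> z /(closed_discS (t := d / 2)); rewrite mulr_ge0 ?(ltW s0)//= => /(_ sd) zy.
  apply: dK; rewrite (splitr d); apply: closed_disc_trans zy => //.
(* The point y + g'(z0) s e^(it) is a competitor in F at g (z0 + s e^(it)), and their difference is
   y - x0 - R. As a majorant of W on the circle about y, Q0 has to be shifted by the angle th. *)
pose Q0 t := F (p (C t), q (C t)) +
  k * ((y.1 - x0.1 - R1 t) ^+ 2 + (y.2 - x0.2 - R2 t) ^+ 2).
have cQ0 : continuous Q0.
  by apply: (cD) => //; apply: (cM) => //; apply: (cD); apply: (cM); exact: (cB).
have pQ0 : periodic2pi Q0.
  by move=> t; rewrite /Q0 /R1 /R2 /C circle_ptD2pi cosD2pi_mul sinD2pi_mul.
have cQ : continuous (fun t => Q0 (t - th)).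
  apply: for_continuous => t; apply: (@continuous_comp _ _ _ (fun t => t - th) Q0).
    by apply: continuousBR; [exact: cvg_id|exact: cvg_cst].
  exact: cQ0.
have WQ t : W (circle_pt y (c * s) t) <= Q0 (t - th).
  set u := t - th; have tE : t = u + th by rewrite /u subrK.
  have Kt : K (circle_pt y (c * s) t).
    by apply/yK/circle_pt_disc; rewrite ger0_norm// mulr_ge0// ltW.
  have := supconv_ge k0 K0 WM' (p (C u), q (C u)) Kt.
  rewrite lerBlDr => /le_trans; apply; rewrite /Q0 lerD2l ler_pM2l//.
  rewrite le_eqVlt; apply/orP; left; apply/eqP; rewrite /sqdist /R1 /R2 /circle_pt /=.
  rewrite tE cosD sinD aE bE; congr (_ ^+ 2 + _ ^+ 2); ring.
have csn : 0 <= c * s by rewrite mulr_ge0// ltW.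
(* At a critical point of g the radius c s is 0, which is why the hypothesis on W includes
   degenerate discs. *)
have := SM y (c * s) _ csn yK cQ WQ.
rewrite (cmean_shift _ cQ0 pQ0) => Wy.
have mQ0 : cmean Q0 = cmean (fun t => F (p (C t), q (C t))) +
    k * (sqdist y x0 + cmean (fun t => R1 t ^+ 2 + R2 t ^+ 2)).
  rewrite cmeanD//; last by apply: (cM) => //; apply: (cD); apply: (cM); exact: (cB).
  rewrite cmeanZ; last by apply: (cD); apply: (cM); exact: (cB).
  congr (_ + _ * _).
  (* The cross terms are linear in the remainders, so they vanish in the mean and only the squares,
     of order e1^2 s^2, survive. *)
  have E t : (y.1 - x0.1 - R1 t) ^+ 2 + (y.2 - x0.2 - R2 t) ^+ 2 =
      sqdist y x0 + (R1 t ^+ 2 + R2 t ^+ 2) -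
      (2 * (y.1 - x0.1) * R1 t + 2 * (y.2 - x0.2) * R2 t).
    by rewrite /sqdist; ring.
  have cRR : continuous (fun t : R => R1 t ^+ 2 + R2 t ^+ 2).
    by apply: (cD); exact: (cM).
  rewrite (eq_cmean E) cmeanB; [|exact: (cD)|by apply: (cD); exact: (cM)].
  rewrite cmeanD// cmean_cst [X in _ - X]cmeanD; [|exact: (cM)|exact: (cM)].
  by rewrite !cmeanZ// mR1 mR2 !mulr0 addr0 subr0.
have mRR : k * cmean (fun t => R1 t ^+ 2 + R2 t ^+ 2) <= e * s ^+ 2.
  apply: (@le_trans _ _ (k * (8 * e1 ^+ 2) * s ^+ 2)); last first.
    by rewrite ler_wpM2r// sqr_ge0.
  rewrite -mulrA ler_pM2l//.
  rewrite -[leRHS](cmean_cst (8 * e1 ^+ 2 * s ^+ 2)); apply: le_cmean => //.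
    by apply: (cD); exact: (cM).
  move=> t _; have [h1 h2] := RB t.
  have sqB (u : R) : `|u| <= e1 * (2 * s) -> u ^+ 2 <= 4 * e1 ^+ 2 * s ^+ 2.
    move=> hu; rewrite -real_normK ?num_real//.
    apply: (@le_trans _ _ ((e1 * (2 * s)) ^+ 2)); last first.
      by rewrite le_eqVlt; apply/orP; left; apply/eqP; ring.
    by rewrite ler_pXn2r// nnegrE (le_trans _ hu).
  have := sqB _ h1; have := sqB _ h2; lra.
rewrite -/F in Hy; move: Wy; rewrite mQ0 mulrDr => Wy.
rewrite -/x0 -/C; lra.
Unshelve. all: by end_near. Qed.

End SupConvolution.

(** * Subharmonic functions *)

Section SubharmonicComposition.
Variable R : realType.
Local Notation plane := (R * R)%type.
Local Notation mu := (@lebesgue_measure R).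
Implicit Types (U V : set plane) (z x y : plane) (w : plane -> \bar R).

Lemma usc_on_comp (S T : topologicalType) (A : set S) (B : set T)
    (f : S -> T) (v : T -> \bar R) :
  open A -> open B -> (forall s, A s -> B (f s)) ->
  (forall s, A s -> {for s, continuous f}) ->
  usc_on B v -> usc_on A (v \o f).
Proof.
move=> oA oB AB cf uv s As; have [voo vlt] := uv _ (AB s As).
split=> // c vc; apply: cvg_within.
have nB : \forall y \near f s, B y -> (v y < c%:E)%E.
  by have := vlt c vc; rewrite near_withinE.
have nA : \forall s' \near s, A s' by exact: open_nbhs_nbhs.
near=> s'; have As' : A s' by near: s'.
have : B (f s') -> (v (f s') < c%:E)%E by near: s'; exact: (cf s As _ nB).
by apply; exact: AB.
Unshelve. all: by end_near. Qed.

Lemma usc_on_nbhs (T : topologicalType) (B : set T) (v : T -> \bar R) t (c : R) :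
  open B -> usc_on B v -> B t -> (v t < c%:E)%E ->
  \forall y \near t, B y /\ (v y < c%:E)%E.
Proof.
move=> oB uv Bt vc; have [_ /(_ _ vc)] := uv t Bt.
rewrite near_withinE => H; near=> y.
have By : B y by near: y; exact: open_nbhs_nbhs.
by split=> //; move: By; near: y.
Unshelve. all: by end_near. Qed.

Lemma usc_measurable (f : R -> \bar R) : usc_on setT f -> measurable_fun setT f.
Proof.
move=> uf; have -> : f = -%E \o (fun t => - f t)%E.
  by apply/funext => t /=; rewrite oppeK.
apply: measurableT_comp => //; apply: lower_semicontinuous_measurable => t c.
rewrite lteNr => ft.
exists [set s | (f s < (- c)%:E)%E]; last by move=> s /=; rewrite lteNr.
apply: filterS (usc_on_nbhs openT uf I ft) => s []; by [].
Qed.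

(** The integral of an upper semicontinuous function may be -oo, so monotonicity is obtained from
    the positive and negative parts instead of integrability. *)
Lemma le_integral_measurable d (T : measurableType d) (m : {measure set T -> \bar R})
    (D : set T) (f g : T -> \bar R) : measurable D ->
  measurable_fun D f -> measurable_fun D g -> (forall t, D t -> f t <= g t)%E ->
  (\int[m]_(x in D) f x <= \int[m]_(x in D) g x)%E.
Proof.
move=> mD mf mg fg; have fg' : {in D, forall t, (f t <= g t)%E}.
  by move=> t; rewrite inE; exact: fg.
rewrite integralE [leRHS]integralE leeB//; apply: ge0_le_integral => //.
- exact: measurable_funepos.
- exact: measurable_funepos.
- by move=> t /mem_set; exact: funepos_le.
- exact: measurable_funeneg.
- exact: measurable_funeneg.
- by move=> t /mem_set; exact: funeneg_le.
Qed.

Lemma usc_on_circle V w z (r : R) : open V -> usc_on V w ->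
  (forall t, V (circle_pt z r t)) -> usc_on setT (fun t => w (circle_pt z r t)).
Proof.
move=> oV uw Vc; apply: (usc_on_comp openT oV) uw => // t _.
by apply: continuous_circle_pt; [exact: cvg_cst|exact: cvg_cst|exact: cvg_id].
Qed.

(** A continuous majorant Q turns the mean inequality into one between real means, and it gives a
    meaning to radius 0, where the circle is the point y. *)
Lemma subharmonic_on_le_cmean V w y (s : R) (Q : R -> R) : open V ->
  subharmonic_on V w -> 0 <= s -> closed_disc y s `<=` V -> continuous Q ->
  (forall t, (w (circle_pt y s t) <= (Q t)%:E)%E) -> (w y <= (cmean Q)%:E)%E.
Proof.
move=> oV [uw sw] s0 yV cQ wQ.
have [s_gt0|] := ltP 0 s; last first.
  move=> sle0; have s_eq0 : s = 0 by apply/eqP; rewrite eq_le sle0.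
  have {}wQ t : (w y <= (Q t)%:E)%E by have := wQ t; rewrite s_eq0 circle_pt0.
  case: (w y) wQ => [c|/(_ 0)|] //.
  - move=> cQ'; rewrite lee_fin -[leLHS]cmean_cst; apply: le_cmean => //.
      by move=> ?; exact: cvg_cst.
    by move=> t _; have := cQ' t; rewrite lee_fin.
  - by move=> _; rewrite leNye.
apply: le_trans (sw y s s_gt0 yV) _; rewrite EFin_cmean//.
rewrite lee_pmul2l ?lte_fin ?invr_gt0 ?pi2_gt0//.
apply: le_integral_measurable => //.
- apply: measurable_funTS; apply: usc_measurable; apply: usc_on_circle oV uw _ => t.
  by apply/yV/circle_pt_disc; rewrite ger0_norm.
- apply/measurable_EFinP; apply: measurable_funTS.
  exact: continuous_measurable_fun.
Qed.

Lemma compact_image_margin V w (p q : plane -> R) (D : set plane) :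
  open V -> usc_on V w -> compact D ->
  (forall z, D z -> V (p z, q z)) ->
  (forall z, D z -> {for z, continuous p}) -> (forall z, D z -> {for z, continuous q}) ->
  exists d M : R, [/\ 0 < d, 0 < M & forall z, D z ->
    [/\ `|p z| <= M, `|q z| <= M & closed_disc (p z, q z) d `<=`
      [set y | V y /\ (w y <= M%:E)%E]]].
Proof.
move=> oV uw /compact_near_coveringP cD DV cp cq.
(* One parameter plays two roles, e as the margin and its inverse as the bound, so that a single
   filter, e tending to 0 from the right, goes through the compactness argument. *)
pose P (e : R) z := [/\ `|p z| <= e^-1, `|q z| <= e^-1 &
  closed_disc (p z, q z) e `<=` [set y | V y /\ (w y <= (e^-1)%:E)%E]].
suff : \forall e \near (0 : R)^'+, forall z, D z -> P e z.
  move=> H; have [e [e0 He]] : exists e : R, 0 < e /\ forall z, D z -> P e z.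
    have : \forall e \near (0 : R)^'+, 0 < e /\ forall z, D z -> P e z.
      by near=> e; split; near: e; [exact: nbhs_right_gt|exact: H].
    by move/(@filter_ex _ _ (at_right_proper_filter 0)).
  by exists e, e^-1; split=> //; rewrite invr_gt0.
apply: (cD R (0 : R)^'+ P) => z Dz.
have [M0 wM0] : exists M0 : R, (w (p z, q z) < M0%:E)%E.
  have [+ _] := uw _ (DV z Dz); case: (w _) => [c _|//|_].
  - by exists (c + 1); rewrite lte_fin ltrDl.
  - by exists 0; rewrite ltNye.
have /nbhs_ballP[r /= r0 Br] := usc_on_nbhs oV uw (DV z Dz) wM0.
pose m := `|M0| + `|p z| + `|q z| + 1.
have m0 : 0 < m by rewrite ltr_wpDl// !addr_ge0.
have r2 : 0 < r / 2 by rewrite divr_gt0.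
have A : \forall z' \near z, [/\ `|p z - p z'| < r / 2, `|q z - q z'| < r / 2,
    `|p z - p z'| < 1 & `|q z - q z'| < 1].
  have cpz := cp z Dz; have cqz := cq z Dz.
  near=> z'; split; near: z'.
  - by move/cvgrPdist_lt : cpz; exact.
  - by move/cvgrPdist_lt : cqz; exact.
  - by move/cvgrPdist_lt : cpz; exact.
  - by move/cvgrPdist_lt : cqz; exact.
have B : \forall e \near (0 : R)^'+, [/\ 0 < e, e < r / 2 & e < m^-1].
  have mV : 0 < m^-1 by rewrite invr_gt0.
  by near=> e; split; near: e; [exact: nbhs_right_gt|exact: (nbhs_right_lt r2)|
                                exact: (nbhs_right_lt mV)].
exists ([set z' | [/\ `|p z - p z'| < r / 2, `|q z - q z'| < r / 2,
    `|p z - p z'| < 1 & `|q z - q z'| < 1]], [set e | [/\ 0 < e, e < r / 2 & e < m^-1]]) => //=.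
move=> [z' e] /= [[h1 h2 h3 h4] [e0 er em]].
have em' : m < e^-1.
  by rewrite -[m]invrK ltf_pV2 ?posrE ?invr_gt0.
have M0m : `|M0| + `|p z| + `|q z| + 1 < e^-1 by exact: em'.
have n1 := normr_ge0 M0; have n2 := normr_ge0 (p z); have n3 := normr_ge0 (q z).
split.
- rewrite -[p z'](subKr (p z)) (le_trans (ler_normB _ _))//; lra.
- rewrite -[q z'](subKr (q z)) (le_trans (ler_normB _ _))//; lra.
- move=> y /(closed_disc_le (ltW e0))[/= y1 y2].
  have [Vy wy] : V y /\ (w y < M0%:E)%E.
    apply: Br; split; rewrite /ball/=.
      rewrite -(subrKA (p z')) (le_lt_trans (ler_normD _ _))//.
      rewrite distrC in y1; lra.
    rewrite -(subrKA (q z')) (le_lt_trans (ler_normD _ _))//.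
    rewrite distrC in y2; lra.
  split=> //; apply: (le_trans (ltW wy)); rewrite lee_fin.
  by have := ler_norm M0; lra.
Unshelve. all: by end_near. Qed.

(** Monotone convergence for the nonnegative increasing functions M - v n. The hypothesis on lower
    bounds says that the infimum of the v n is at most f, which is the inequality needed for the
    limit. *)
Lemma le_integral_approx (f : R -> \bar R) (v : (R -> R)^nat) (M c : R) :
  measurable_fun setT f -> (forall n, continuous (v n)) ->
  (forall t, f t <= M%:E)%E -> (forall n t, v n t <= M) ->
  (forall m n t, (m <= n)%N -> v n t <= v m t) ->
  (forall t (b : R), (forall n, b <= v n t) -> (b%:E <= f t)%E) ->
  (forall n, c <= cmean (v n)) ->
  (c%:E <= (2 * pi)^-1%:E * \int[mu]_(t in `[0%R, (2 * pi)%R]) f t)%E.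
Proof.
move=> mf cv fM vM vdec vf cle.
pose D : set R := `[0, 2 * pi]%classic.
have mD : measurable D by exact: measurable_itv.
have mu2 : mu D = (2 * pi)%:E.
  by rewrite lebesgue_measure_itv/= lte_fin pi2_gt0 oppr0 addr0.
pose h n t : \bar R := (M - v n t)%:E.
have cB n : continuous (fun t => M - v n t).
  by apply: for_continuous => t; apply: continuousBR; [exact: cvg_cst|exact: cv].
have mh n : measurable_fun D (h n).
  apply/measurable_EFinP; apply: measurable_funTS; exact: continuous_measurable_fun.
have h0 n t : D t -> (0 <= h n t)%E by move=> _; rewrite lee_fin subr_ge0.
have hnd t : D t -> nondecreasing_seq (h ^~ t).
  by move=> _ m n mn; rewrite lee_fin lerD2l lerN2 vdec.
have hI n : (\int[mu]_(t in D) h n t <= (2 * pi * (M - c))%:E)%E.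
  have E : (\int[mu]_(t in D) h n t)%E = (2 * pi * cmean (fun t => M - v n t))%:E.
    rewrite /cmean mulrA mulfV ?pi2_neq0// mul1r fineK//.
    by rewrite integrable_fin_num//; exact: continuous_integrable_itv.
  rewrite E lee_fin ler_pM2l ?pi2_gt0// cmeanB ?cmean_cst ?lerD2l ?lerN2//.
  by move=> ?; exact: cvg_cst.
pose g t : \bar R := (M%:E - f t)%E.
have g0 t : D t -> (0 <= g t)%E by move=> _; rewrite /g sube_ge0 ?orbT.
have mg : measurable_fun D g.
  by apply: emeasurable_funB; [exact: measurable_cst|exact: measurable_funTS].
have hcvg t : D t -> h ^~ t @ \oo --> ereal_sup (range (h ^~ t)).
  by move=> Dt; apply: ereal_nondecreasing_cvgn; exact: hnd.
have gle t : D t -> (g t <= limn (h ^~ t))%E.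
  move=> Dt; rewrite (cvg_lim _ (hcvg t Dt))//.
  have hub n : (h n t <= ereal_sup (range (h ^~ t)))%E.
    by apply: ereal_sup_ubound; exists n.
  case E : (ereal_sup _) hub => [l| |] hub; last 2 first.
  - by rewrite leey.
  - by have := hub 0%N; rewrite leeNy_eq.
  have Ml : ((M - l)%:E <= f t)%E.
    by apply: vf => n; have := hub n; rewrite lee_fin lerBlDl -lerBlDr.
  rewrite /g; move: Ml (fM t); case: (f t) => [x|_|] //.
  by rewrite -EFinB !lee_fin => Ml _; lra.
have gI : (\int[mu]_(t in D) g t <= (2 * pi * (M - c))%:E)%E.
  apply: (@le_trans _ _ (\int[mu]_(t in D) limn (h ^~ t))%E).
    apply: ge0_le_integral => //.
    apply: (emeasurable_fun_cvg h) => // t Dt.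
    by rewrite (cvg_lim _ (hcvg t Dt)); [exact: hcvg|].
  rewrite monotone_convergence//.
  apply: lime_le; last by apply: nearW => n; exact: hI.
  apply: ereal_nondecreasing_is_cvgn => m n mn.
  apply: ge0_le_integral => //; [exact: h0|exact: mh|exact: mh|].
  by move=> t Dt; exact: hnd.
(* The bound just obtained makes M - f integrable, so that the integral of f = M - (M - f) can be
   split. *)
have ig : mu.-integrable D g.
  apply/integrableP; split => //.
  have -> : (\int[mu]_(t in D) `|g t| = \int[mu]_(t in D) g t)%E.
    by apply: eq_integral => t; rewrite inE => Dt; rewrite gee0_abs// g0.
  exact: le_lt_trans gI (ltry _).
have iM : mu.-integrable D (cst M%:E).
  by apply: continuous_integrable_itv => x; exact: cvg_cst.
have -> : (\int[mu]_(t in D) f t = \int[mu]_(t in D) (cst M%:E \- g)%E t)%E.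
  apply: eq_integral => t _; rewrite /g /=.
  have := fM t; case: (f t) => //= x _.
  by rewrite -!EFinB; congr EFin; ring.
have iC : (\int[mu]_(t in D) cst M%:E t = (M * (2 * pi))%:E)%E.
  by rewrite integral_cst// EFinM; congr (_ * _)%E; exact: mu2.
rewrite integralB// iC.
have G0 : (0 <= \int[mu]_(t in D) g t)%E by exact: integral_ge0.
case: (\int[mu]_(t in D) g t)%E gI G0 => [G|//|//]; rewrite !lee_fin => GC _.
by rewrite ler_pdivlMl ?pi2_gt0//; lra.
Qed.

Lemma subharmonic_on_comp U V w (p q a b : plane -> R) :
  open U -> open V -> subharmonic_on V w -> holomorphic U p q a b ->
  (forall z, U z -> V (p z, q z)) ->
  subharmonic_on U (fun z => w (p z, q z)).
Proof.
move=> oU oV sw hU UV; have [uw _] := sw; have [P Q] := hU.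
have cp z : U z -> {for z, continuous p} by exact: (hasC1_continuous oU P).
have cq z : U z -> {for z, continuous q} by exact: (hasC1_continuous oU Q).
have cpq z : U z -> {for z, continuous (fun z => (p z, q z))}.
  by move=> Uz; apply: continuous_pair; [exact: cp|exact: cq].
have ucomp := usc_on_comp oU oV UV cpq uw.
split=> // c r r0 cU.
set D := closed_disc c r in cU.
have cD : compact D by exact: compact_closed_disc (ltW r0).
have [d [M [d0 M0 HD]]] := compact_image_margin oV uw cD
  (fun z Dz => UV z (cU z Dz)) (fun z Dz => cp z (cU z Dz)) (fun z Dz => cq z (cU z Dz)).
(* The closed d-neighborhood of the image of the disc: bounded, inside V, with w <= M on it, and
   containing room d around every g(z). *)
pose K : set plane := [set y | exists2 z, D z & closed_disc (p z, q z) d y].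
have KV y : K y -> V y /\ (w y <= M%:E)%E.
  by move=> [z Dz zy]; have [_ _] := HD z Dz; exact.
have KB y : K y -> `|y.1| <= M + d /\ `|y.2| <= M + d.
  move=> [z Dz zy]; have [h1 h2 _] := HD z Dz.
  have [/= h3 h4] := closed_disc_le (ltW d0) zy.
  rewrite -[y.1](subrK (p z)) -[y.2](subrK (q z)) (addrC M).
  by split; rewrite (le_trans (ler_normD _ _))// lerD.
have gK z : D z -> closed_disc (p z, q z) d `<=` K.
  by move=> Dz y yz; exists z.
have gz_K z : D z -> K (p z, q z).
  by move=> Dz; apply: (gK z Dz); rewrite closed_discE sqdistxx sqr_ge0.
have Dc : D c by rewrite /D closed_discE sqdistxx sqr_ge0.
have K0 : K !=set0 by exists (p c, q c); exact: gz_K.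
pose W (n : nat) y : R := fine (maxe (w y) (- n%:R)%:E).
have WE n y : V y -> (W n y)%:E = maxe (w y) (- n%:R)%:E.
  move=> Vy; have [woo _] := uw y Vy; rewrite /W fineK//.
  by move: woo; case: (w y) => [s _|//|_]; rewrite ?maxNye// -EFin_max.
have WM n y : K y -> - n%:R <= W n y <= M.
  move=> Ky; have [Vy wM] := KV y Ky.
  rewrite -!lee_fin WE// le_max lexx orbT/= ge_max wM lee_fin/=.
  by rewrite (@le_trans _ _ 0)// ?oppr_le0// ltW.
(* The mean inequality survives truncation, because a majorant of [W n] on the circle is a majorant
   of both w and the constant -n. *)
have SM n y (s : R) (Q' : R -> R) : 0 <= s -> closed_disc y s `<=` K ->
    continuous Q' -> (forall t, W n (circle_pt y s t) <= Q' t) -> W n y <= cmean Q'.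
  move=> s0 yK cQ WQ.
  have yV : closed_disc y s `<=` V by move=> x /yK/KV[].
  have Vy : V y by apply: yV; rewrite closed_discE sqdistxx sqr_ge0.
  have WQ' t : (maxe (w (circle_pt y s t)) (- n%:R)%:E <= (Q' t)%:E)%E.
    rewrite -WE ?lee_fin//; apply/yV/circle_pt_disc; by rewrite ger0_norm.
  rewrite -lee_fin WE// ge_max; apply/andP; split.
    apply: (subharmonic_on_le_cmean oV sw s0 yV cQ) => t.
    by have := WQ' t; rewrite ge_max => /andP[].
  rewrite lee_fin -[leLHS]cmean_cst; apply: le_cmean => //.
    by move=> ?; exact: cvg_cst.
  by move=> t _; have := WQ' t; rewrite ge_max lee_fin => /andP[].
(* The factor M + n + 1 is what [supconv_asymptotic] requires for the bounds -n and M. The factor n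
   + 1 confines near-maximizers to squared distance (d / 2)^2 / (n + 1), which tends to 0. *)
pose k (n : nat) : R := (M + n%:R + 1) * n.+1%:R * (2 / d) ^+ 2.
have M1 n : 0 < M + n%:R + 1 by rewrite ltr_wpDl// addr_ge0// ltW.
have k0 n : 0 < k n.
  by rewrite /k mulr_gt0 ?exprn_gt0 ?divr_gt0// mulr_gt0.
have kE n : k n * (d / 2) ^+ 2 = (M + n%:R + 1) * n.+1%:R.
  by rewrite /k; field; rewrite gt_eqF.
have k_mono m n : (m <= n)%N -> k m <= k n.
  move=> mn; rewrite /k ler_wpM2r ?sqr_ge0// ler_pM ?ler_nat//.
    exact: ltW.
  by rewrite lerD2r lerD2l ler_nat.
have WM' n y : K y -> W n y <= M by move=> /(WM n)/andP[].
pose F n := supconv (W n) K (k n).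
pose v n z := F n (p z, q z).
have Fge n x y : K y -> W n y - k n * sqdist y x <= F n x.
  exact: (supconv_ge (ltW (k0 n)) K0 (WM' n)).
have Fle n x (e : R) : (forall y, K y -> W n y - k n * sqdist y x <= e) -> F n x <= e.
  exact: (supconv_le (ltW (k0 n)) K0 (WM' n)).
have cv n z : U z -> {for z, continuous (v n)}.
  move=> Uz; apply: (@continuous_comp _ _ _ (fun z => (p z, q z)) (F n)).
    exact: cpq.
  exact: (continuous_supconv (ltW (k0 n)) K0 KB (WM' n)).
have submean n : v n c <= cmean (fun t => v n (circle_pt c r t)).
  apply: (submean_of_asymptotic oU r0 cU (cv n)) => z Dz e e0.
  apply: (@supconv_asymptotic R U p q a b (W n) K (k n) (M + d) M (- n%:R) d z oU
    hU (cU z Dz) KB (WM n) (SM n) d0 (gK z Dz) (ltW (k0 n)) _ e e0).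
  rewrite kE opprK ler_peMr//; first exact: ltW.
  by rewrite ler1n.
have Ucirc t : D (circle_pt c r t) by apply: circle_pt_disc; rewrite ger0_norm// ltW.
have wc_oo : (w (p c, q c) < +oo)%E by have [] := uw _ (UV c (cU c Dc)).
have [wNy|wNNy] := eqVneq (w (p c, q c)) -oo%E; first by rewrite wNy leNye.
have wcE : w (p c, q c) = (fine (w (p c, q c)))%:E.
  by move: wc_oo wNNy; case: (w _).
rewrite wcE.
apply: (@le_integral_approx (fun t => w (p (circle_pt c r t), q (circle_pt c r t)))
  (fun n t => v n (circle_pt c r t)) M).
- by apply: usc_measurable; apply: (usc_on_circle oU ucomp) => t; exact/cU/Ucirc.
- move=> n; apply: for_continuous => t.
  apply: (@continuous_comp _ _ _ (fun t => circle_pt c r t) (v n)).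
    by apply: continuous_circle_pt; [exact: cvg_cst|exact: cvg_cst|exact: cvg_id].
  exact/cv/cU/Ucirc.
- by move=> t; case: (KV _ (gz_K _ (Ucirc t))).
- move=> n t; apply: Fle => y Ky; rewrite (le_trans _ (WM' n y Ky))// gerBl.
  by rewrite mulr_ge0 ?sqdist_ge0// ltW.
- move=> m n t mn; apply: Fle => y Ky; apply: le_trans (Fge m _ y Ky).
  have [Vy _] := KV y Ky.
  apply: lerB; last by rewrite ler_wpM2r ?sqdist_ge0// k_mono.
  rewrite -lee_fin !WE// ge_max le_max lexx/= le_max lee_fin lerN2 ler_nat mn.
  by rewrite orbT.
(* If w x < e - e', semicontinuity keeps w below e - e' on a ball about x. For large n the
   near-maximizers lie in that ball, whence [F n x] <= e - e', contradicting the lower bound e. *)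
- move=> t e ev; set x := (p _, q _).
  have Dt := Ucirc t.
  apply/lee_addgt0Pr => e' e'0; rewrite leNgt; apply/negP => we.
  have xV : V x by exact: UV (cU _ Dt).
  have wx : (w x < (e - e')%:E)%E by rewrite EFinB lteBrDr.
  have /nbhs_ballP[s /= s0 Bs] := usc_on_nbhs oV uw xV wx.
  have s2 : 0 < s ^+ 2 by rewrite exprn_gt0.
  have d22 : 0 < (d / 2) ^+ 2 by rewrite exprn_gt0// divr_gt0.
  (* The first entry puts the truncation level -n below e - e'; the second makes (d / 2)^2 / (n + 1)
     smaller than s^2. *)
  pose A := Num.max (e' - e) ((d / 2) ^+ 2 / s ^+ 2).
  pose n := (Num.truncn A).+1.
  have nA : A < n%:R by exact: truncnS_gt.
  have n1 : - n%:R <= e - e'.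
    by rewrite lerNl opprB (le_trans _ (ltW nA))// le_max lexx.
  have n2 : (d / 2) ^+ 2 < n.+1%:R * s ^+ 2.
    rewrite -ltr_pdivrMr// (lt_trans (y := n%:R)) ?ltr_nat//.
    by rewrite (le_lt_trans _ nA)// le_max lexx orbT.
  have : F n x <= e - e'.
    apply/ler_addgt0Pl => e2 e20.
    pose e3 := Num.min 1 e2.
    have e30 : 0 < e3 by rewrite lt_min ltr01.
    have [y Ky Hy] := supconv_adherent (ltW (k0 n)) K0 (WM' n) x e30.
    rewrite -/(F n) in Hy.
    have e31 : e3 <= 1 by rewrite ge_min lexx.
    have e32 : e3 <= e2 by rewrite ge_min lexx orbT.
    have Fx : - n%:R <= F n x.
      apply: le_trans (Fge n x x (gz_K _ Dt)); rewrite sqdistxx mulr0 subr0.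
      by case/andP: (WM n _ (gz_K _ Dt)).
    have yx : k n * sqdist y x <= M + n%:R + 1.
      by have := WM' n y Ky; lra.
    have yx2 : sqdist y x < s ^+ 2.
      rewrite -(ltr_pM2l (k0 n)) (le_lt_trans yx)//.
      by rewrite -(ltr_pM2r d22) mulrAC kE -!mulrA ltr_pM2l//.
    have By : ball x s y.
      have lt_s (i j : R) : i ^+ 2 + j ^+ 2 < s ^+ 2 -> `|i| < s.
        move=> ij; rewrite -(@ltr_pXn2r _ 2%N)// ?nnegrE ?(ltW s0)//.
        by rewrite real_normK ?num_real// (le_lt_trans _ ij)// lerDl sqr_ge0.
      have B1 : `|x.1 - y.1| < s by rewrite distrC; exact: lt_s yx2.
      have B2 : `|x.2 - y.2| < s.
        by rewrite distrC; move: yx2; rewrite /sqdist addrC; exact: lt_s.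
      exact: (conj B1 B2).
    have [_ wy] := Bs y By.
    have Wy : W n y <= e - e'.
      have [Vy _] := KV y Ky.
      by rewrite -lee_fin WE// ge_max (ltW wy) lee_fin.
    have := mulr_ge0 (ltW (k0 n)) (sqdist_ge0 y x); lra.
  have := ev n; rewrite -/x /v -/(F n x) => h1 h2; lra.
- move=> n; apply: le_trans (submean n); rewrite -lee_fin -wcE.
  apply: (@le_trans _ _ (W n (p c, q c))%:E).
    by rewrite WE ?le_max ?lexx//; exact: UV (cU c Dc).
  rewrite lee_fin; apply: le_trans (Fge n _ _ (gz_K c Dc)).
  by rewrite sqdistxx mulr0 subr0.
Qed.

End SubharmonicComposition.

(** * Slices *)

Section Slices.
Variable R : realType.
Local Notation plane := (R * R)%type.
Local Notation H := (quaternion R).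
Implicit Types (U : set plane) (w : plane -> \bar R) (I : H).

Lemma subharmonic_on_eq U w w' : open U -> (forall z, U z -> w z = w' z) ->
  subharmonic_on U w -> subharmonic_on U w'.
Proof.
move=> oU ww' [uw sw]; split.
  move=> z Uz; have [woo wlt] := uw z Uz; rewrite -ww'//; split => // a /wlt.
  rewrite !near_withinE; apply: filterS => y yw Uy.
  by rewrite -ww'//; exact: yw.
move=> a r r0 aU; rewrite -ww'; last first.
  by apply: aU; rewrite closed_discE sqdistxx sqr_ge0.
rewrite (le_trans (sw a r r0 aU))// le_eqVlt; apply/orP; left; apply/eqP.
congr (_ * _)%E; apply: eq_integral => t _; apply: ww'.
by apply/aU/circle_pt_disc; rewrite ger0_norm// ltW.
Qed.

Lemma harmonic_on_eq U w w' : open U -> (forall z, U z -> w z = w' z) ->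
  harmonic_on U w -> harmonic_on U w'.
Proof.
move=> oU ww' [wf [W W1 W2] W0].
have fE z : U z -> (fine \o w) z = (fine \o w') z by move=> /ww' /= ->.
have {}W := C1_on_hasC1 oU W; have {}W1 := C1_on_hasC1 oU W1.
have {}W2 := C1_on_hasC1 oU W2.
have F := hasC1_eq_on oU fE (fun _ _ => erefl) (fun _ _ => erefl) W.
have gx z (Uz : U z) := esym (hasC1_partial F Uz).1.
have gy z (Uz : U z) := esym (hasC1_partial F Uz).2.
have F1 := hasC1_eq_on oU gx (fun _ _ => erefl) (fun _ _ => erefl) W1.
have F2 := hasC1_eq_on oU gy (fun _ _ => erefl) (fun _ _ => erefl) W2.
split.
- by move=> z Uz; rewrite -ww'// wf.
- by split; [exact: hasC1_C1_on F|exact: hasC1_C1_on F1|exact: hasC1_C1_on F2].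
- move=> z Uz; rewrite /laplacian (hasC1_partial F1 Uz).1 (hasC1_partial F2 Uz).2.
  exact: W0.
Qed.

Lemma is_derive_linear (X V W : normedModType R) (L : V -> W) (f : X -> V)
    (x v : X) (d : V) :
  (forall a b, L (a - b) = L a - L b) -> (forall (k : R) a, L (k *: a) = k *: L a) ->
  {for d, continuous L} -> is_derive x v f d -> is_derive x v (L \o f) (L d).
Proof.
move=> LB LZ cL [df dE].
have C : (fun h => h^-1 *: (((L \o f) \o shift x) (h *: v) - (L \o f) x)) @ 0^' --> L d.
  rewrite (_ : (fun h => _) =
    L \o (fun h => h^-1 *: ((f \o shift x) (h *: v) - f x))); last first.
    by apply/funext => h /=; rewrite LZ LB.
  apply: continuous_cvg => //; rewrite -dE; exact: df.
by split; [apply/cvg_ex; exists (L d)|exact/cvg_lim].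
Qed.

(** If the real part a were nonzero, the equations 2 a b = 2 a c = 2 a d = 0 would leave a^2 =
    -1. *)
Lemma imaginary_sphereP I : imaginary_sphere I ->
  qcoord 0 I = 0 /\ qcoord 1 I ^+ 2 + qcoord 2 I ^+ 2 + qcoord 3 I ^+ 2 = 1.
Proof.
elim/quaternionW: I => a b c d; rewrite /imaginary_sphere /= expr2 quat_mulE => E.
have m1 : -1 = quat (-1) 0 0 0 :> H.
  by apply/rowP => -[[|[|[|[|//]]]]] ?; rewrite !mxE ?oppr0.
rewrite m1 in E; rewrite !qcoordE.
have := congr1 (qcoord 0) E; have := congr1 (qcoord 1) E.
have := congr1 (qcoord 2) E; have := congr1 (qcoord 3) E.
rewrite !qcoordE => E3 E2 E1 E0.
have [a0|a0] := eqVneq a 0; first by split=> //; rewrite a0 in E0; lra.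
have b0 : b = 0 by apply: (mulfI a0); lra.
have c0 : c = 0 by apply: (mulfI a0); lra.
have d0 : d = 0 by apply: (mulfI a0); lra.
have := sqr_ge0 a; rewrite b0 c0 d0 in E0; lra.
Qed.

Lemma slice_ptE I (z : plane) : imaginary_sphere I ->
  slice_pt I z = quat z.1 (z.2 * qcoord 1 I) (z.2 * qcoord 2 I) (z.2 * qcoord 3 I).
Proof.
move=> /imaginary_sphereP[I0 _].
move: I0; elim/quaternionW: I => a b c d; rewrite !qcoordE => ->.
have oneE : 1 = quat 1 0 0 0 :> H by [].
rewrite /slice_pt oneE !quat_scaleE quat_addE.
by rewrite !mulr0 !add0r addr0 mulr1.
Qed.

Lemma continuous_qcoord i : continuous (@qcoord R i).
Proof. by move=> q; exact: coord_continuous. Qed.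

Lemma qcoordB i (p q : H) : qcoord i (p - q) = qcoord i p - qcoord i q.
Proof. by rewrite /qcoord !mxE. Qed.

Lemma qcoordZ i (k : R) (q : H) : qcoord i (k *: q) = k *: qcoord i q.
Proof. by rewrite /qcoord !mxE. Qed.

Lemma slice_ptB I (y z : plane) : slice_pt I (y - z) = slice_pt I y - slice_pt I z.
Proof. by rewrite /slice_pt /= !scalerBl opprD addrACA. Qed.

Lemma slice_ptZ I (k : R) (z : plane) : slice_pt I (k *: z) = k *: slice_pt I z.
Proof. by rewrite /slice_pt /= scalerDr !scalerA. Qed.

Lemma slice_ptD I (y z : plane) : slice_pt I (y + z) = slice_pt I y + slice_pt I z.
Proof. by rewrite /slice_pt /= !scalerDl addrACA. Qed.

Lemma imaginary_mul_slice_pt I (z : plane) : imaginary_sphere I ->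
  I * slice_pt I z = slice_pt I (- z.2, z.1).
Proof.
move=> II; rewrite /slice_pt mulrDr -!scalerAr mulr1 -expr2 II /=.
by rewrite scalerN scaleNr addrC.
Qed.

Lemma slice_pt_eq0 I (z : plane) : imaginary_sphere I -> slice_pt I z = 0 -> z = 0.
Proof.
move=> II; rewrite slice_ptE// => E.
have [_ Inorm] := imaginary_sphereP II.
have q0 i : qcoord i (0 : H) = 0 by rewrite /qcoord mxE.
have := congr1 (qcoord 0) E; have := congr1 (qcoord 1) E.
have := congr1 (qcoord 2) E; have := congr1 (qcoord 3) E.
rewrite !qcoordE !q0 => E3 E2 E1 E0.
case: z E0 E1 E2 E3 {E} => x y /= -> E1 E2 E3; congr pair.
rewrite -[LHS]mulr1 -Inorm !mulrDr !expr2 !mulrA E1 E2 E3.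
by rewrite !mul0r !addr0.
Qed.

Lemma slice_cauchy_riemann I (x y : H) (x0 x1 y0 y1 : R) : imaginary_sphere I ->
  x = slice_pt I (x0, x1) -> y = slice_pt I (y0, y1) -> x + I * y = 0 ->
  y0 = - x1 /\ y1 = x0.
Proof.
move=> II -> ->; rewrite imaginary_mul_slice_pt// -slice_ptD => /(slice_pt_eq0 II).
by move=> /pair_equal_spec[/= E0 E1]; split; lra.
Qed.

Lemma continuous_slice_pt I : continuous (slice_pt I).
Proof.
move=> z; rewrite /slice_pt; apply: (@cvgD _ H).
  by apply: (@cvgZr_tmp _ H); exact: cvg_fst.
by apply: (@cvgZr_tmp _ H); exact: cvg_snd.
Qed.

Lemma open_slice_coord I (Omega : set H) : open Omega -> open (slice_coord I Omega).
Proof.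
by move=> oO; apply: open_comp => // z _; exact: continuous_slice_pt.
Qed.

Lemma hasC1_qcoord U (F : plane -> H) (L : H -> R) : open U -> C1_on U F ->
  (forall a b, L (a - b) = L a - L b) -> (forall (k : R) a, L (k *: a) = k *: L a) ->
  continuous L -> hasC1 U (L \o F) (L \o partial_x F) (L \o partial_y F).
Proof.
move=> oU [dF cx cy] LB LZ cL z Uz; have [dx dy] := dF z Uz.
have E (h : plane -> H) : {within U, continuous h} -> {for z, continuous h}.
  by rewrite (continuous_open_subspace h oU) => /(_ z (mem_set Uz)).
split.
- exact: (is_derive_linear LB LZ (cL _) (derivableP dx)).
- exact: (is_derive_linear LB LZ (cL _) (derivableP dy)).
- exact: (@continuous_comp _ _ _ (partial_x F) L z (E _ cx) (cL _)).
- exact: (@continuous_comp _ _ _ (partial_y F) L z (E _ cy) (cL _)).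
Qed.

Lemma slice_regular_holomorphic I (Omega : set H) (f : H -> H) :
  imaginary_sphere I -> open Omega -> slice_regular Omega f ->
  slice_preserving Omega f ->
  exists p q a b, holomorphic (slice_coord I Omega) p q a b /\
    forall z, slice_coord I Omega z -> f (slice_pt I z) = slice_pt I (p z, q z).
Proof.
move=> II oO fR fS; have [C1 CR] := fR I II; have fI := fS I II.
have oU : open (slice_coord I Omega) by exact: open_slice_coord.
set U := slice_coord I Omega in oU C1 CR *.
have [I0 Inorm] := imaginary_sphereP II.
set F := f \o slice_pt I in C1 CR.
(* The inner product with the unit vector I recovers the coordinate y of x + y I. Being linear and
   continuous on all of H, it carries the C1 property of F over to q. *)
pose L (q : H) := qcoord 1 I * qcoord 1 q + qcoord 2 I * qcoord 2 q +
  qcoord 3 I * qcoord 3 q.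
have LB a b : L (a - b) = L a - L b by rewrite /L !qcoordB; ring.
have LZ (k : R) a : L (k *: a) = k *: L a.
  by rewrite /L !qcoordZ /GRing.scale/=; ring.
have cL : continuous L.
  move=> q; have cq i : {for q, continuous (fun y : H => qcoord i I * qcoord i y)}.
    apply: (@continuousMR R H); first exact: (@cst_continuous H R).
    exact: (@continuous_qcoord i q).
  apply: (@continuousDR R H); last exact: cq.
  by apply: (@continuousDR R H); exact: cq.
have hC i : hasC1 U (qcoord i \o F) (qcoord i \o partial_x F) (qcoord i \o partial_y F).
  apply: hasC1_qcoord => //; [exact: qcoordB|exact: qcoordZ|exact: continuous_qcoord].
have hL := hasC1_qcoord oU C1 LB LZ cL.
pose p := qcoord 0 \o F; pose q := L \o F.
have FE z : U z -> F z = slice_pt I (p z, q z).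
  move=> Uz; have [|[x y] _ xy] := fI (F z).
    by exists (slice_pt I z) => //; split=> //; exists z.
  rewrite -[RHS]/(slice_pt I (qcoord 0 (F z), L (F z))) -xy; congr slice_pt.
  rewrite !slice_ptE//= /L !qcoordE; congr pair.
  by rewrite -[LHS]mulr1 -Inorm; ring.
have FC z i : U z -> (0 < i < 4)%N -> qcoord i (F z) = q z * qcoord i I.
  by move=> Uz; rewrite FE// slice_ptE//; case: i => [|[|[|[|//]]]] _ //; rewrite qcoordE.
(* The partial derivatives of F also lie in the plane of I: differentiate the identities [FC] and
   compare. This permits splitting the quaternionic equation into the two real Cauchy-Riemann
   equations. *)
have PX z i : U z -> (0 < i < 4)%N ->
    qcoord i (partial_x F z) = L (partial_x F z) * qcoord i I /\
    qcoord i (partial_y F z) = L (partial_y F z) * qcoord i I.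
  move=> Uz i4.
  have h1 := hasC1_eq_on oU (fun z Uz => FC z i Uz i4) (fun _ _ => erefl)
    (fun _ _ => erefl) (hC i).
  have h2 := hasC1Z (qcoord i I) hL.
  have {}h2 := hasC1_eq_on oU (fun z _ => mulrC (qcoord i I) (q z)) (fun _ _ => erefl)
    (fun _ _ => erefl) h2.
  have [x1 y1] := hasC1_partial h1 Uz; have [x2 y2] := hasC1_partial h2 Uz.
  by split; [rewrite -[LHS]x1 x2 mulrC|rewrite -[LHS]y1 y2 mulrC].
have CRE z : U z -> qcoord 0 (partial_y F z) = - L (partial_x F z) /\
    L (partial_y F z) = qcoord 0 (partial_x F z).
  move=> Uz.
  have E : partial_x F z + I * partial_y F z = 0.
    have := CR z Uz; move/(congr1 (fun q => 2 *: q)).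
    by rewrite scalerA mulfV ?scale1r ?scaler0// pnatr_eq0.
  have FX (d : H) (l : R) : (forall i, (0 < i < 4)%N -> qcoord i d = l * qcoord i I) ->
      d = slice_pt I (qcoord 0 d, l).
    move=> dE; rewrite slice_ptE//=; apply: quaternionP => -[|[|[|[|//]]]] _;
      by rewrite qcoordE// dE.
  have EX := FX _ _ (fun i i4 => (PX z i Uz i4).1).
  have EY := FX _ _ (fun i i4 => (PX z i Uz i4).2).
  exact: slice_cauchy_riemann II EX EY E.
exists p, q, (qcoord 0 \o partial_x F), (L \o partial_x F).
split; last exact: FE.
split.
  exact: hasC1_eq_on oU (fun _ _ => erefl) (fun _ _ => erefl)
    (fun z Uz => (CRE z Uz).1) (hC 0%N).
exact: hasC1_eq_on oU (fun _ _ => erefl) (fun _ _ => erefl)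
  (fun z Uz => (CRE z Uz).2) hL.
Qed.

Lemma slice_regular_id (Omega : set H) : open Omega -> slice_regular Omega id.
Proof.
move=> oO I II.
have D (z v : plane) : is_derive z v (slice_pt I) (slice_pt I v).
  exact: (is_derive_linear (slice_ptB I) (slice_ptZ I)
    (@continuous_slice_pt I v) (is_derive_id z v)).
have Px : partial_x (slice_pt I) = fun=> slice_pt I (1, 0).
  by apply/funext => z; have [] := D z (1, 0).
have Py : partial_y (slice_pt I) = fun=> slice_pt I (0, 1).
  by apply/funext => z; have [] := D z (0, 1).
split; first split.
- by move=> z _; split; apply: (@ex_derive _ _ _ _ _ _ _ (D z _)).
- by rewrite Px; apply: continuous_subspaceT => z; exact: cvg_cst.
- by rewrite Py; apply: continuous_subspaceT => z; exact: cvg_cst.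
move=> z _; rewrite Px Py /slice_pt /= !scale0r !scale1r add0r addr0.
by rewrite -expr2 II subrr scaler0.
Qed.

End Slices.

Theorem theorem4p2 (R : realType) (Omega : set (quaternion R))
    (u : quaternion R -> \bar R) (hOmega : domain Omega) (hu : us Omega u) :
  (weakly_subharmonic Omega u <->
     forall (Omega' : set (quaternion R)) (f : quaternion R -> quaternion R),
       domain Omega' -> f @` Omega' `<=` Omega ->
       slice_regular Omega' f -> slice_preserving Omega' f ->
       weakly_subharmonic Omega' (u \o f)) /\
  (weakly_harmonic Omega u <->
     forall (Omega' : set (quaternion R)) (f : quaternion R -> quaternion R),
       domain Omega' -> f @` Omega' `<=` Omega ->
       slice_regular Omega' f -> slice_preserving Omega' f ->
       weakly_harmonic Omega' (u \o f)).
Proof.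
have [_ oOmega _] := hOmega.
have idO : (id : quaternion R -> _) @` Omega `<=` Omega by move=> _ [q Oq <-].
have idR : slice_regular Omega id by exact: slice_regular_id.
have idP : slice_preserving Omega id by move=> I _ _ [q [_ Iq] <-].
have comp (Omega' : set (quaternion R)) (f : quaternion R -> quaternion R) I :
    imaginary_sphere I -> domain Omega' -> f @` Omega' `<=` Omega ->
    slice_regular Omega' f -> slice_preserving Omega' f ->
    exists p q a b, [/\ open (slice_coord I Omega'), open (slice_coord I Omega),
      holomorphic (slice_coord I Omega') p q a b,
      forall z, slice_coord I Omega' z -> slice_coord I Omega (p z, q z) &
      forall z, slice_coord I Omega' z ->
        (u \o slice_pt I) (p z, q z) = (u \o f \o slice_pt I) z].
  move=> II [_ oOmega' _] fO fR fP.
  have [p [q [a [b [hol fE]]]]] := slice_regular_holomorphic II oOmega' fR fP.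
  exists p, q, a, b; split=> //; try exact: open_slice_coord.
    by move=> z Uz; rewrite /slice_coord /= -fE//; apply: fO; exists (slice_pt I z).
  by move=> z Uz /=; rewrite fE.
split; split=> [sub Omega' f dOmega' fO fR fP I II|H].
- have [p [q [a [b [oU oV hol UV E]]]]] := comp _ _ _ II dOmega' fO fR fP.
  exact: subharmonic_on_eq oU E (subharmonic_on_comp oU oV (sub I II) hol UV).
- exact: (H Omega id hOmega idO idR idP).
- have [p [q [a [b [oU oV hol UV E]]]]] := comp _ _ _ II dOmega' fO fR fP.
  exact: harmonic_on_eq oU E (harmonic_on_comp oU oV (sub I II) hol UV).
- exact: (H Omega id hOmega idO idR idP).
Qed.
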